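(* Let $p,q\in[1,\infty)$. (i) If $-\infty<\alpha_1\le\alpha_2<\infty$, then $JNQ^{\alpha_1}_{p,q}(\mathbb{R}^n)\supset JNQ^{\alpha_2}_{p,q}(\mathbb{R}^n)$. (ii) If $\alpha\in\mathbb{R}$ satisfies $\alpha>n\left(\frac1q-\frac1p\right)$ or $\alpha\ge 1$, then $JNQ^{\alpha}_{p,q}(\mathbb{R}^n)=\{0\}$. (iii) If $\alpha\in(-\infty,0)$, then $JNQ^{\alpha}_{p,q}(\mathbb{R}^n)=JN^{\mathrm{con}}_{p,q}(\mathbb{R}^n)$ with equivalent norms.
   Context: Here $n\in\mathbb{N}$, $n\ge1$. A measurable function $f$ on $\mathbb{R}^n$ is a Lebesgue measurable function with $|f|<\infty$ almost everywhere. A cube has finite positive edge length and all its edges parallel to the coordinate axes, and need not be open or closed. For $\ell\in(0,\infty)$, $\Pi_\ell$ is the class of all collections $\{Q_j\}_j$ of cubes of $\mathbb{R}^n$ with pairwise disjoint interiors and equal edge length $\ell$. For a bounded measurable set $E$ with $|E|>0$, $f_E:=\frac1{|E|}\int_E f\,dy$ and $\frac{1}{|E|}\int_E$ denotes averaging. For $p,q\in[1,\infty)$ and $\alpha\in\mathbb{R}$, the space $JNQ^{\alpha}_{p,q}(\mathbb{R}^n)$ is the set of all measurable $f$ on $\mathbb{R}^n$ with $$\|f\|_{JNQ^\alpha_{p,q}(\mathbb{R}^n)}:=\sup_{\ell\in(0,\infty),\,\{Q_j\}_j\in\Pi_\ell}\Big\{\sum_j|Q_j|\,[\Phi_{f,q,\alpha}(Q_j)]^p\Big\}^{1/p}<\infty,\qquad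 \Phi_{f,q,\alpha}(Q):=\Big[|Q|^{\frac{q\alpha}{n}-1}\int_Q\int_Q\frac{|f(x)-f(y)|^q}{|x-y|^{n+q\alpha}}\,dy\,dx\Big]^{1/q}.$$ The space $JN^{\mathrm{con}}_{p,q}(\mathbb{R}^n)$ is the set of all $f\in L^1_{\mathrm{loc}}(\mathbb{R}^n)$ with $$\|f\|_{JN^{\mathrm{con}}_{p,q}(\mathbb{R}^n)}:=\sup_{\ell\in(0,\infty),\,\{Q_j\}_j\in\Pi_\ell}\Big\{\sum_j|Q_j|\Big[\frac1{|Q_j|}\int_{Q_j}|f(x)-f_{Q_j}|^q\,dx\Big]^{p/q}\Big\}^{1/p}<\infty.$$ These are regarded as function spaces modulo constants, and $\{0\}$ denotes the set of functions that are constant almost everywhere. ''Equivalent norms'' means that each is bounded by a positive constant, independent of $f$, times the other. *)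

(* Defs.v *)
From HB Require Import structures.
From mathcomp Require Import all_boot all_order all_algebra.
From mathcomp Require Import all_classical all_reals all_analysis.
From mathcomp Require Import measurable_realfun.
Set Implicit Arguments.
Unset Strict Implicit.
Unset Printing Implicit Defensive.
Import Order.TTheory GRing.Theory Num.Theory.
Import numFieldNormedType.Exports.
Local Open Scope classical_set_scope.
Local Open Scope ring_scope.
Local Open Scope ereal_scope.

(* The product (= Borel) sigma-algebra on R^n, generated by the coordinates;
   this is the construction the library uses for [n.-tuple T].               *)
Definition rV_coord {R : realType} {n : nat} (i : 'I_n) (x : 'rV[R]_n) :
  measurableTypeR R := x ord0 i.

Definition rV_display : measure_display. Proof. exact. Qed.

Section borel_rV.
Context {R : realType} {n : nat}.

Let rV_set0 : g_sigma_preimage (@rV_coord R n) set0.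
Proof. exact: sigma_algebra0. Qed.

Let rV_setC A :
  g_sigma_preimage (@rV_coord R n) A -> g_sigma_preimage (@rV_coord R n) (~` A).
Proof. exact: sigma_algebraC. Qed.

Let rV_bigcup (F : (set 'rV[R]_n)^nat) :
  (forall i, g_sigma_preimage (@rV_coord R n) (F i)) ->
  g_sigma_preimage (@rV_coord R n) (\bigcup_i (F i)).
Proof. exact: sigma_algebra_bigcup. Qed.

HB.instance Definition _ := @isMeasurable.Build rV_display
  'rV[R]_n (g_sigma_preimage (@rV_coord R n)) rV_set0 rV_setC rV_bigcup.

Lemma measurable_rV_coord (i : 'I_n) : measurable_fun [set: 'rV[R]_n] (rV_coord i).
Proof.
move=> _ Y mY; rewrite setTI; apply: sub_sigma_algebra.
rewrite (bigD1 i)//=; left; exists Y => //; by rewrite setTI.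
Qed.

Lemma measurable_rV d (T : measurableType d) (f : T -> 'rV[R]_n) :
  (forall i, measurable_fun setT (rV_coord i \o f)) -> measurable_fun setT f.
Proof.
move=> mf.
apply: (@measurability _ _ _ _ _ _
  (\big[setU/set0]_(i < n) preimage_set_system setT (@rV_coord R n i) measurable)).
  by [].
move=> _ [B + <-].
elim/big_ind : _ => //; first by move=> X Y HX HY [/HX|/HY].
by move=> i _ [Y mY <-]; rewrite !setTI; have := mf i measurableT Y mY; rewrite setTI.
Qed.

End borel_rV.

Definition rV_cons {R : realType} (n : nat)
    (xt : 'rV[R]_n * measurableTypeR R) : 'rV[R]_n.+1 :=
  \row_(i < n.+1) oapp (fun j => xt.1 ord0 j) xt.2 (unlift ord0 i).

Lemma measurable_rV_cons {R : realType} (n : nat) :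
  measurable_fun [set: 'rV[R]_n * measurableTypeR R] (@rV_cons R n).
Proof.
apply: measurable_rV => i.
case: (unliftP ord0 i) => [j ij|i0].
  rewrite (_ : _ \o _ = rV_coord j \o fst); last first.
    by apply/funext => x; rewrite /= /rV_coord /rV_cons mxE ij liftK.
  by apply: measurableT_comp; [exact: measurable_rV_coord|exact: measurable_fst].
rewrite (_ : _ \o _ = snd); first exact: measurable_snd.
by apply/funext => x; rewrite /= /rV_coord /rV_cons mxE i0 unlift_none.
Qed.

Definition lebesgue_cons {R : realType} (n : nat)
    (mu : {measure set 'rV[R]_n -> \bar R}) : set 'rV[R]_n.+1 -> \bar R :=
  pushforward (mu \x @lebesgue_measure R) (@rV_cons R n).

HB.instance Definition _ (R : realType) (n : nat)
    (mu : {measure set 'rV[R]_n -> \bar R}) :=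
  Measure.copy (lebesgue_cons mu)
    (measure_function_pushforward__canonical__measure_function_Measure
       (mu \x @lebesgue_measure R) (@measurable_rV_cons R n)).

(* The n-fold product of [lebesgue_measure], on the Borel sets. *)
Fixpoint borel_lebesgue (R : realType) (n : nat) :
    {measure set 'rV[R]_n -> \bar R} :=
  match n with
  | 0 => \d_(0%R : 'rV[R]_0)
  | m.+1 => lebesgue_cons (borel_lebesgue R m)
  end.

(* The completion: [lebesgue_rV R n] is 'rV[R]_n with the sigma-algebra of
   Lebesgue measurable sets.                                                 *)
Definition lebesgue_rV (R : realType) (n : nat) : Type :=
  caratheodory_type (borel_lebesgue R n)^*%mu.

HB.instance Definition _ (R : realType) (n : nat) :=
  Measurable.copy (lebesgue_rV R n)
    (caratheodory_type (borel_lebesgue R n)^*%mu).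

Definition lebesgue {R : realType} {n : nat} :
    set (lebesgue_rV R n) -> \bar R :=
  @completed_measure_extension _ _ R (borel_lebesgue R n).

HB.instance Definition _ (R : realType) (n : nat) :=
  Measure.copy (@lebesgue R n)
    (@completed_measure_extension _ _ R (borel_lebesgue R n)).

Section function_spaces.
Context {R : realType} {n : nat}.
Notation Rn := 'rV[R]_n.
Notation leb := (@lebesgue R n).
Implicit Types (f : Rn -> \bar R) (Q K : set Rn) (p q alpha l : R).

(* The library norm on 'rV[R]_n is the maximum norm. *)
Definition euclid_dist (x y : Rn) : R :=
  Num.sqrt (\sum_(i < n) (x ord0 i - y ord0 i) ^+ 2).

Definition lebesgue_measurable f : Prop :=
  measurable_fun [set: lebesgue_rV R n] f /\
  {ae leb, forall x, f x \is a fin_num}.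

(* Each face may be included or not; in terms of bounds, [BLeft a] is "just
   before a" and [BRight a] "just after a".                                  *)
Definition cube l : set (set Rn) :=
  [set Q | exists (a : Rn) (b c : 'I_n -> bool),
     Q = [set x : Rn | forall i, x ord0 i \in
       Interval (BSide (b i) (a ord0 i)) (BSide (c i) (a ord0 i + l)%R)]].

(* Two distinct indices of a family with pairwise disjoint interiors carry
   distinct cubes, so a collection can be given as a set of cubes.           *)
Definition congruent_cubes l : set (set (set Rn)) :=
  [set C | C `<=` cube l /\ trivIset C (@interior Rn)].

Definition congruent_sup p (a : set Rn -> \bar R) : \bar R :=
  ereal_sup [set (\esum_(Q in C) a Q) `^ p^-1 |
             C in \bigcup_(l in [set l : R | (0 < l)%R]) congruent_cubes l].

(* The kernel has a finite junk value at x = y, which is a null set for n >= 1. *)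
Definition Phi f q alpha Q : \bar R :=
  (leb Q `^ (q * alpha / n%:R - 1) *
   \int[leb]_(x in Q) \int[leb]_(y in Q)
     (`|f x - f y| `^ q *
      (euclid_dist x y `^ (n%:R + q * alpha))^-1%:E)) `^ q^-1.

Definition JNQ_norm p q alpha f : \bar R :=
  congruent_sup p (fun Q => leb Q * Phi f q alpha Q `^ p).

Definition JNQ p q alpha : set (Rn -> \bar R) :=
  [set f | lebesgue_measurable f /\ JNQ_norm p q alpha f < +oo].

Definition mean f Q : \bar R := (leb Q)^-1 * \int[leb]_(x in Q) f x.

Definition L1loc : set (Rn -> \bar R) :=
  [set f | lebesgue_measurable f /\
           forall K, compact K -> leb.-integrable K f].

Definition JNcon_norm p q f : \bar R :=
  congruent_sup p (fun Q =>
    leb Q * mean (fun x => `|f x - mean f Q| `^ q) Q `^ (p / q)).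

Definition JNcon p q : set (Rn -> \bar R) :=
  [set f | L1loc f /\ JNcon_norm p q f < +oo].

(* The space {0}, functions being taken modulo constants. *)
Definition ae_constant : set (Rn -> \bar R) :=
  [set f | exists c : R, {ae leb, forall x, f x = c%:E}].

Definition equivalent_norms (X : set (Rn -> \bar R))
    (N1 N2 : (Rn -> \bar R) -> \bar R) : Prop :=
  exists c1 c2 : R, [/\ (0 < c1)%R, (0 < c2)%R &
    forall f, X f -> N1 f <= c1%:E * N2 f /\ N2 f <= c2%:E * N1 f].

End function_spaces.

(* Main.v *)
Require Import Defs.
From HB Require Import structures.
From mathcomp Require Import all_boot all_order all_algebra.
From mathcomp Require Import all_classical all_reals all_analysis.
From mathcomp Require Import measurable_realfun.
From mathcomp Require Import ring lra.
Set Implicit Arguments.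
Unset Strict Implicit.
Unset Printing Implicit Defensive.
Import Order.TTheory GRing.Theory Num.Theory.
Import numFieldNormedType.Exports.
Local Open Scope classical_set_scope.
Local Open Scope ring_scope.

(** For a cube [Q] of edge [l], write [E_s(Q)] for the energy, the integral over
[Q x Q] of [|g x - g y|^q / |x - y|^s]. Then [Phi(Q)^q] is
[l^(q alpha - n) E_s(Q)] with [s = n + q alpha], and the other seminorm is built
in the same way from the mean oscillation [V(Q)], the average of
[|g - g_Q|^q] over [Q]. Both seminorms are monotone and homogeneous in the
quantity attached to each cube, so every comparison reduces to one cube
([congruent_seminorm_scale]).

On a cube [|x - y| <= n l]. Hence raising the exponent of the kernel costs only
a power of [n l], and [Phi] for a small [alpha] is bounded by [Phi] for a larger
one ([Phi_exponent_le]); this is (i).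

For every [alpha], [V(Q)] is bounded by a constant times [Phi(Q)^q]. By Jensen's inequality [V(Q)]
is at most the double average of [|g x - g y|^q]; to bring in the kernel, go from
[x] to [y] through a third point [z] of [Q] at distance at least [l/8] from both,
where the kernel is comparable with [l^(-s)], and average over such [z], which
fill at least half of [Q] ([diffq_le_inner]). For [alpha < 0] the converse
holds: compare [g x] and [g y] with the mean and use that the kernel
[|x - y|^(-s)], [s < n], is integrable in [y] ([inner_kernel_le]). This gives
(iii); the first bound also shows that the functions of the fractional space
are locally integrable.

For (ii), finiteness of the seminorm on single cubes bounds
[l^delta E_s(Q)^(1/q)] with [delta = alpha - n (1/q - 1/p)]
([JNQ_energy_le]). If [delta > 0], large cubes force all energies to vanish,
because the energy increases with the cube; and a function of zero energy is
constant almost everywhere ([energy_eq0_ae_const]). If [alpha >= 1], reduce to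
[alpha = 1] by (i). There the kernel scales exactly so that going from [x] to [y]
through their midpoint shows that the part of the energy carried by
[|x - y| <= r] is at most the part carried by [|x - y| <= r/2]
([near_energy_half]). Iterating, a finite energy is concentrated on the
diagonal, where the integrand is zero, so it is zero ([energy_lty_eq0]).

The midpoint argument composes [g] with an affine map of [R^n x R^n]; this keeps
Borel measurability but not Lebesgue measurability. So a Lebesgue measurable
function is first replaced by a Borel function [g], equal to it off a Borel null
set ([borel_representative]), and all estimates are made for [g] and the measure
on Borel sets. *)

(** * Lebesgue measure of cubes *)

(** The measure on Borel sets, as a function of its own so that it can carry
the sigma-finite structure that Fubini's theorem asks for. *)
Definition vol {R : realType} {n : nat} : set 'rV[R]_n -> \bar R :=
  borel_lebesgue R n.
HB.instance Definition _ (R : realType) (n : nat) :=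
  Measure.copy (@vol R n) (borel_lebesgue R n).

Lemma volS {R : realType} n (A : set 'rV[R]_n.+1) :
  vol A = (@vol R n \x lebesgue_measure)%E (@rV_cons R n @^-1` A).
Proof. by []. Qed.

Lemma vol_box {R : realType} n (I : 'I_n -> interval R) (l : R) :
  (forall i, lebesgue_measure [set` I i] = l%:E) ->
  measurable [set x : 'rV[R]_n | forall i, x ord0 i \in I i] /\
  vol [set x : 'rV[R]_n | forall i, x ord0 i \in I i] = (l ^+ n)%:E.
Proof.
elim: n I => [|n IH] I lI.
  have -> : [set x : 'rV[R]_0 | forall i, x ord0 i \in I i] = setT.
    by apply/seteqP; split => // x _ [].
  by split; rewrite // /vol /= diracT.
have [mB vB] := IH (fun i => I (lift ord0 i)) (fun i => lI _).
split.
  have -> : [set x : 'rV[R]_n.+1 | forall i, x ord0 i \in I i] =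
    \bigcap_(i in [set: 'I_n.+1]) (rV_coord i @^-1` [set` I i]).
    by apply/seteqP; split => x /= h i; [move=> _; exact: h|exact: (h i)].
  apply: fin_bigcap_measurable; first exact: finite_finset.
  by move=> i _; rewrite -[X in measurable X]setTI; exact: measurable_rV_coord.
rewrite volS.
set A := [set x : 'rV[R]_n | forall i, x ord0 i \in I (lift ord0 i)] in mB vB.
have -> : @rV_cons R n @^-1` [set x | forall i, x ord0 i \in I i] =
          A `*` [set` I ord0].
  apply/seteqP; split => -[x t] /=.
    move=> h; split.
      move=> i; have := h (lift ord0 i).
      by rewrite /rV_cons mxE liftK.
    by have := h ord0; rewrite /rV_cons mxE unlift_none.
  move=> [hA h0] i; rewrite /rV_cons mxE; case: unliftP => [j ->|->] //=.
transitivity (vol A * lebesgue_measure [set` I ord0])%E; last first.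
  by rewrite vB lI -EFinM exprSr.
exact: product_measure1E.
Qed.

Lemma lebesgue_measure_side {R : realType} (a l : R) (b c : bool) : 0 < l ->
  lebesgue_measure [set` Interval (BSide b a) (BSide c (a + l))] = l%:E.
Proof.
move=> l0; rewrite lebesgue_measure_itv/= lte_fin ltrDl l0.
by rewrite -EFinB addrAC subrr add0r.
Qed.

Lemma vol_cube {R : realType} n (l : R) (Q : set 'rV[R]_n) : 0 < l -> cube l Q ->
  measurable Q /\ vol Q = (l ^+ n)%:E.
Proof.
move=> l0 [a [b [c ->]]]; apply: vol_box => i; exact: lebesgue_measure_side.
Qed.

(** Closed cubes serve both as balls of the maximum norm and as an exhaustion
of the space. *)
Definition centred_cube {R : realType} n (c : 'rV[R]_n) (r : R) : set 'rV[R]_n :=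
  [set x | forall i, x ord0 i \in `[c ord0 i - r, c ord0 i + r]].

Lemma centred_cubeP {R : realType} n (c : 'rV[R]_n) (r : R) :
  cube (2 * r) (centred_cube c r).
Proof.
exists (\row_i (c ord0 i - r)), (fun=> true), (fun=> false).
apply/seteqP; split => x /= h i; have := h i; rewrite !mxE.
  by have -> : c ord0 i - r + 2 * r = c ord0 i + r by rewrite mulr2n mulrDl mul1r addrA subrK.
by have -> : c ord0 i - r + 2 * r = c ord0 i + r by rewrite mulr2n mulrDl mul1r addrA subrK.
Qed.

Lemma exists_centred_cube {R : realType} n (x : 'rV[R]_n) :
  exists k : nat, centred_cube 0 k.+1%:R x.
Proof.
exists (Num.bound (\sum_i `|x ord0 i|)) => i.
rewrite mxE sub0r add0r in_itv/= -ler_norml.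
apply: (@le_trans _ _ (\sum_i `|x ord0 i|)).
  by rewrite (bigD1 i)//= lerDl; apply: sumr_ge0.
apply: ltW; apply: lt_le_trans (archi_boundP _) _; first exact: sumr_ge0.
by rewrite ler_nat.
Qed.

Lemma vol_sigma_finite {R : realType} n : sigma_finite setT (@vol R n).
Proof.
exists (fun k => centred_cube 0 k.+1%:R).
  by apply/seteqP; split => // x _; have [k] := exists_centred_cube x; exists k.
move=> k; have [mQ vQ] := vol_cube (mulr_gt0 (ltr0n _ 2) (ltr0n _ k.+1)) (centred_cubeP (0 : 'rV[R]_n) k.+1%:R).
by split => //; rewrite vQ ltry.
Qed.

HB.instance Definition _ (R : realType) (n : nat) :=
  Measure_isSigmaFinite.Build _ _ _ (@vol R n) (@vol_sigma_finite R n).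

(** * Euclidean distance and powers *)

Section distance.
Context {R : realType} {n : nat}.
Implicit Types (x y : 'rV[R]_n) (l : R).

Lemma euclid_dist_ge0 x y : 0 <= euclid_dist x y.
Proof. exact: sqrtr_ge0. Qed.

Lemma euclid_distC x y : euclid_dist x y = euclid_dist y x.
Proof.
by congr Num.sqrt; apply: eq_bigr => i _; rewrite -sqrrN opprB.
Qed.

Lemma coord_le_euclid_dist x y i : `|x ord0 i - y ord0 i| <= euclid_dist x y.
Proof.
rewrite -sqrtr_sqr ler_wsqrtr// (bigD1 i)//= lerDl.
by apply: sumr_ge0 => j _; exact: sqr_ge0.
Qed.

Lemma euclid_distxx x : euclid_dist x x = 0.
Proof.
by rewrite /euclid_dist big1 ?sqrtr0// => i _; rewrite subrr expr0n.
Qed.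

Lemma euclid_dist_eq0 x y : euclid_dist x y = 0 -> x = y.
Proof.
move=> xy0; apply/rowP => i; apply/eqP; rewrite -subr_eq0 -normr_le0 -xy0.
exact: coord_le_euclid_dist.
Qed.

Lemma euclid_dist_le x y l : (0 < n)%N -> 0 <= l ->
  (forall i, `|x ord0 i - y ord0 i| <= l) -> euclid_dist x y <= n%:R * l.
Proof.
move=> n0 l0 h.
have nl0 : 0 <= n%:R * l by rewrite mulr_ge0.
rewrite -[leRHS]ger0_norm// -sqrtr_sqr ler_wsqrtr//.
apply: (@le_trans _ _ (\sum_(i < n) l ^+ 2)).
  by apply: ler_sum => i _; rewrite -real_normK ?num_real// lerXn2r ?nnegrE.
rewrite sumr_const card_ord -[leLHS]mulr_natl exprMn; apply: ler_wpM2r; first exact: sqr_ge0.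
by rewrite expr2 ler_peMr// ler1n.
Qed.

Lemma cube_coord_le l (Q : set 'rV[R]_n) x y : cube l Q -> Q x -> Q y ->
  forall i, `|x ord0 i - y ord0 i| <= l.
Proof.
move=> [a [b [c ->]]] /= Qx Qy i.
have bnd z : z \in Interval (BSide (b i) (a ord0 i)) (BSide (c i) (a ord0 i + l)) ->
    a ord0 i <= z <= a ord0 i + l.
  rewrite in_itv => /andP[h1 h2]; apply/andP; split.
    by move: h1; case: (b i) => //= /ltW.
  by move: h2; case: (c i) => //= /ltW.
have /andP[h1 h2] := bnd _ (Qx i); have /andP[h3 h4] := bnd _ (Qy i).
by rewrite ler_norml; apply/andP; split; lra.
Qed.

Lemma cube_midpoint l (Q : set 'rV[R]_n) x y : cube l Q -> Q x -> Q y ->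
  Q (2^-1 *: (x + y)).
Proof.
move=> [a [b [c ->]]] /= Qx Qy i; rewrite !mxE.
have := Qx i; have := Qy i; rewrite !in_itv => /andP[h1 h2] /andP[h3 h4].
apply/andP; split.
  by move: h1 h3; case: (b i) => /= ? ?; lra.
by move: h2 h4; case: (c i) => /= ? ?; lra.
Qed.

Lemma euclid_dist_midpoint x y :
  euclid_dist x (2^-1 *: (x + y)) = 2^-1 * euclid_dist x y.
Proof.
rewrite /euclid_dist -[X in X * _](@ger0_norm _ 2^-1)//.
rewrite -sqrtr_sqr -sqrtrM ?sqr_ge0//.
congr Num.sqrt; rewrite mulr_sumr; apply: eq_bigr => i _.
by rewrite !mxE -exprMn; congr (_ ^+ 2); lra.
Qed.

Lemma measurable_euclid_dist :
  measurable_fun setT (fun z : 'rV[R]_n * 'rV[R]_n => euclid_dist z.1 z.2).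
Proof.
have -> : (fun z : 'rV[R]_n * 'rV[R]_n => euclid_dist z.1 z.2) =
  (fun z => (\sum_(i < n) (rV_coord i z.1 - rV_coord i z.2) ^+ 2) `^ (2^-1)).
  apply/funext => z; rewrite powR12_sqrt//.
  by apply: sumr_ge0 => i _; exact: sqr_ge0.
have mS : measurable_fun setT (fun z : 'rV[R]_n * 'rV[R]_n =>
    \sum_(i < n) (rV_coord i z.1 - rV_coord i z.2) ^+ 2); last first.
  exact: (measurableT_comp (measurable_powR 2^-1) mS).
apply: measurable_sum => i; apply: measurable_funX.
by apply: measurable_funB; apply: measurableT_comp => //; exact: measurable_rV_coord.
Qed.

Lemma far_centred_cube x y l : ~ centred_cube x l y -> l <= euclid_dist x y.
Proof.
move=> /existsNP[i]; rewrite in_itv/= -ler_distlC => /negP; rewrite -ltNge.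
move=> /ltW h; apply: le_trans h (coord_le_euclid_dist _ _ _).
Qed.

End distance.

Section power_inequalities.
Context {R : realType}.
Implicit Types (a b u v q s : R).

(** Young's inequality for the conjugate exponents [q] and [q / (q - 1)];
equivalently, the graph of [u ^ q] lies above its tangent at [a]. *)
Lemma young_tangent q u a : 1 <= q -> 0 <= u -> 0 < a ->
  q * a `^ (q - 1) * u <= u `^ q + (q - 1) * a `^ q.
Proof.
rewrite le_eqVlt => /predU1P[<- u0 a0|q1 u0 a0].
  by rewrite subrr powRr0 mul0r addr0 powRr1// !mul1r.
have q0 : 0 < q by lra.
pose q' := q / (q - 1).
have q1' : 0 < q - 1 by lra.
have q'0 : 0 < q' by rewrite divr_gt0.
have qN0 : q != 0 by rewrite gt_eqF.
have qN1 : q - 1 != 0 by rewrite gt_eqF.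
have qq' : q^-1 + q'^-1 = 1 by rewrite /q'; field; rewrite ?qN0 ?qN1.
have := conjugate_powR u0 (powR_ge0 a (q - 1)) q0 q'0 qq'.
rewrite -powRrM (_ : (q - 1) * q' = q); last by rewrite /q'; field; rewrite ?qN0 ?qN1.
rewrite -(ler_pM2l q0) => h.
rewrite -mulrA [X in q * X]mulrC (le_trans h)//.
rewrite mulrDr [q * (u `^ q / q)]mulrC divfK ?gt_eqF// lerD2l.
by rewrite mulrA [_ / q'](_ : _ = (q - 1) * a `^ q)// /q'; field; rewrite ?qN0 ?qN1.
Qed.
(** Convexity of the power: add the tangent inequalities for [u] and [v] at the
midpoint [(u + v) / 2]. *)
Lemma powR_add_le q u v : 1 <= q -> 0 <= u -> 0 <= v ->
  (u + v) `^ q <= 2 `^ (q - 1) * (u `^ q + v `^ q).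
Proof.
move=> q1 u0 v0; have q0 : 0 < q by lra.
have [uv0|uv0] := eqVneq (u + v) 0.
  rewrite uv0 powR0 ?gt_eqF// mulr_ge0 ?powR_ge0// addr_ge0 ?powR_ge0//.
pose a := (u + v) / 2.
have a0 : 0 < a by rewrite divr_gt0// lt0r uv0 addr_ge0.
have hu := young_tangent q1 u0 a0; have hv := young_tangent q1 v0 a0.
have aq : a * a `^ (q - 1) = a `^ q by rewrite mulr_powRB1// ltW.
have uvE : u + v = 2 * a by rewrite /a; field.
have h : 2 * a `^ q <= u `^ q + v `^ q.
  have : q * a `^ (q - 1) * (u + v) = 2 * q * a `^ q by rewrite uvE -aq; ring.
  nra.
rewrite uvE powRM ?(ltW a0)//.
rewrite -(@mulr_powRB1 _ 2 q)// mulrAC mulrC ler_wpM2l ?powR_ge0//.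
Qed.

Lemma powR_dist_le q u v w : 1 <= q ->
  `|u - v| `^ q <= 2 `^ (q - 1) * (`|u - w| `^ q + `|w - v| `^ q).
Proof.
move=> q1; apply: le_trans (powR_add_le q1 (normr_ge0 _) (normr_ge0 _)).
rewrite ge0_ler_powR ?nnegrE ?addr_ge0//; first lra.
by rewrite -[u - v](subrKA w) ler_normD.
Qed.

(** Away from [0] and at the scale [l], the kernel is comparable with its value
at distance [l], whatever the sign of the exponent. *)
Lemma powR_comparable s N : 1 <= N -> exists2 c, 0 < c &
  forall l d, 0 < l -> l / N <= d -> d <= N * l -> c / l `^ s <= (d `^ s)^-1.
Proof.
move=> N1; exists (N `^ (- `|s|)); first by rewrite powR_gt0; lra.
move=> l d l0 ld dl.
have N0 : 0 < N by lra.
have d0 : 0 < d by apply: lt_le_trans ld; rewrite divr_gt0.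
have t1 : N^-1 <= d / l by rewrite ler_pdivlMr// mulrC.
have t2 : d / l <= N by rewrite ler_pdivrMr.
have t0 : 0 < d / l by rewrite divr_gt0.
rewrite -!powRN.
have -> : d `^ (- s) = (d / l) `^ (- s) * l `^ (- s).
  by rewrite -powRM ?(ltW t0) ?(ltW l0)// divfK// gt_eqF.
apply: ler_wpM2r; first exact: powR_ge0.
have [s0|s0] := leP 0 s.
  rewrite ger0_norm// !powRN lef_pV2 ?posrE ?powR_gt0//.
  by rewrite ge0_ler_powR ?nnegrE ?(ltW t0) ?(ltW N0).
have -> : N `^ (- `|s|) = N^-1 `^ (- s).
  by rewrite ltr0_norm// opprK -(powR_inv1 (ltW N0)) -powRrM mulN1r opprK.
by rewrite ge0_ler_powR ?nnegrE ?invr_ge0 ?(ltW t0) ?(ltW N0)// oppr_ge0 ltW.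
Qed.

End power_inequalities.

Local Open Scope ereal_scope.

(** * The midpoint change of variables *)

Lemma integral_volS {R : realType} n (h : 'rV[R]_n.+1 -> \bar R) :
  measurable_fun setT h -> (forall x, 0 <= h x) ->
  \int[vol]_x h x = \int[vol]_x \int[lebesgue_measure]_t h (rV_cons (x, t)).
Proof.
move=> mh h0.
transitivity (\int[(@vol R n \x lebesgue_measure)]_z (h \o @rV_cons R n) z).
  exact: (ge0_integral_pushforward (@measurable_rV_cons R n)).
rewrite (@fubini_tonelli1 _ _ _ _ _ (@vol R n) (@lebesgue_measure R))//.
- by apply: measurableT_comp => //; exact: measurable_rV_cons.
- by move=> z; exact: h0.
Qed.

(** Both sides are integrals against measures on the line that agree on
half-open intervals. *)
Lemma integral_midpoint1 {R : realType} (c : R) (h : R -> \bar R) :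
  measurable_fun setT h -> (forall x, 0 <= h x) ->
  \int[lebesgue_measure]_t h (2^-1 * (c + t))%R =
  2%:E * \int[lebesgue_measure]_t h t.
Proof.
move=> mh h0.
pose phi (t : measurableTypeR R) : measurableTypeR R := (2^-1 * (c + t))%R.
have mphi : measurable_fun setT phi.
  apply: measurable_funM => //; apply: measurable_funD => //.
have half0 : (0 <= 2^-1 :> R)%R by [].
pose half : {nonneg R} := NngNum half0.
pose m : {measure set measurableTypeR R -> \bar R} := 
  mscale half (measure_function_pushforward__canonical__measure_function_Measure (@lebesgue_measure R) mphi).
have mE A : measurable A -> lebesgue_measure A = m A.
  apply: lebesgue_measure_unique => _ [[a b] _ <-] /=.
  rewrite /m /mscale /= /pushforward.
  have -> : phi @^-1` `]a, b] = `](2 * a - c)%R, (2 * b - c)%R]%classic.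
    apply/seteqP; split => t; rewrite /phi /= !in_itv/= => /andP[h1 h2];
      apply/andP; split; lra.
  rewrite !lebesgue_measure_itv/= !lte_fin ltrD2r ltr_pM2l//.
  case: ifPn => _; last by rewrite mule0.
  rewrite -!EFinB -EFinM; congr EFin.
  by rewrite opprB addrA subrK -mulrBr mulKf.
transitivity (\int[pushforward lebesgue_measure phi]_t h t).
  by rewrite (ge0_integral_pushforward mphi).
rewrite [in RHS](@eq_measure_integral _ _ _ setT m)//; last by move=> A mA _; exact: mE.
rewrite /m ge0_integral_mscale// muleA -EFinM divff// mul1e//.
Qed.

Lemma measurable_midpoint {R : realType} n :
  measurable_fun setT (fun z : 'rV[R]_n * 'rV[R]_n => 2^-1 *: (z.1 + z.2))%R.
Proof.
apply: measurable_rV => i.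
rewrite (_ : _ \o _ = (fun z => 2^-1 * (rV_coord i z.1 + rV_coord i z.2))%R).
  apply: measurable_funM => //; apply: measurable_funD.
    by apply: measurableT_comp => //; exact: measurable_rV_coord.
  by apply: measurableT_comp => //; exact: measurable_rV_coord.
by apply/funext => z; rewrite /rV_coord /= !mxE.
Qed.

(** The map acts on each coordinate separately, so induction on the dimension
and Tonelli's theorem reduce it to the line. *)
Lemma integral_midpoint {R : realType} n (c : 'rV[R]_n) (h : 'rV[R]_n -> \bar R) :
  measurable_fun setT h -> (forall x, 0 <= h x) ->
  \int[vol]_y h (2^-1 *: (c + y))%R = (2 ^+ n)%:E * \int[vol]_y h y.
Proof.
elim: n c h => [|n IH] c h mh h0.
  rewrite expr0 mul1e; apply: eq_integral => y _; congr h.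
  by apply/rowP => -[].
have mid (x : 'rV[R]_n) (t : R) : (2^-1 *: (c + rV_cons (x, t)))%R =
   rV_cons (2^-1 *: ((\row_i c ord0 (lift ord0 i)) + x), 2^-1 * (c ord0 ord0 + t))%R.
  apply/rowP => i; rewrite !mxE /=; case: unliftP => [j ->|->] /=; by rewrite ?mxE.
have mhc : measurable_fun setT (fun z : 'rV[R]_n * measurableTypeR R => h (rV_cons z)).
  by apply: measurableT_comp => //; exact: measurable_rV_cons.
have mhx x : measurable_fun setT (fun t : measurableTypeR R => h (rV_cons (x, t))).
  exact: (measurableT_comp mhc).
rewrite integral_volS//; last first.
  apply: measurableT_comp => //.
  exact: (measurableT_comp (@measurable_midpoint R n.+1) (pair1_measurable c)).
under eq_integral.
  move=> x _; under eq_integral do rewrite mid.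
  rewrite (integral_midpoint1 (c ord0 ord0) (mhx _))//.
  over.
have mF : measurable_fun setT (fun x => \int[lebesgue_measure]_t h (rV_cons (x, t))).
  exact: (measurable_fun_fubini_tonelli_F (m2 := @lebesgue_measure R) (fun z => h (rV_cons z)) mhc).
pose H x := 2%:E * \int[lebesgue_measure]_t h (rV_cons (x, t)).
transitivity ((2 ^+ n)%:E * \int[vol]_x H x).
  apply: (IH (\row_i c ord0 (lift ord0 i)) H); first exact: measurable_funeM.
  by move=> x; rewrite mule_ge0// integral_ge0.
rewrite ge0_integralZl//; last by move=> x _; exact: integral_ge0.
by rewrite -integral_volS// muleA -EFinM exprSr.
Qed.

(** * Lebesgue measurable functions and Borel functions *)

Section completion.
Context {R : realType} {n : nat}.
Notation Rn := 'rV[R]_n.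
Notation L := (lebesgue_rV R n).
Notation leb := (@lebesgue R n).

Lemma borel_leb_measurable (A : set Rn) :
  measurable A -> measurable (A : set L).
Proof. by move=> mA; exact: caratheodory_measurable_mu_ext. Qed.

Lemma leb_borelE (A : set Rn) : measurable A -> leb A = vol A.
Proof. by move=> mA; exact: measurable_mu_extE. Qed.

Lemma leb_complete : measure_is_complete leb.
Proof. exact: measure_is_complete_caratheodory. Qed.

Lemma le_leb (A B : set Rn) : A `<=` B -> leb A <= leb B.
Proof. exact: le_mu_ext. Qed.

Lemma leb_sigma_finite : sigma_finite [set: L] leb.
Proof. exact/completed_measure_extension_sigma_finite/vol_sigma_finite. Qed.

(** Intersect countably many countable covers whose measures approach the outer
measure. *)
Lemma borel_hull (A : set Rn) :
  exists B, [/\ measurable B, A `<=` B & vol B = leb A].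
Proof.
have [Aoo|Afin] := eqVneq (leb A) +oo.
  exists setT; split => //; rewrite Aoo -leb_borelE//; apply/eqP.
  by rewrite -leye_eq -Aoo le_leb.
have {}Afin : leb A \is a fin_num by rewrite ge0_fin_numE ?ltey// mu_ext_ge0.
have F k : exists F : (set Rn)^nat, measurable_cover A F /\
    \sum_(i <oo) vol (F i) < leb A + (k.+1%:R^-1)%:E.
  have k0 : (0 < k.+1%:R^-1 :> R)%R by rewrite invr_gt0.
  have [_ [F cF <-] h] := lb_ereal_inf_adherent k0 Afin.
  by exists F.
pose G k := \bigcup_i (sval (cid (F k))) i.
have cG k : measurable_cover A (sval (cid (F k))) by case: cid => ? [].
have mG k : measurable (G k).
  by apply: bigcupT_measurable => i; exact: (cG k).1.
have GA k : A `<=` G k := (cG k).2.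
have vG k : vol (G k) <= leb A + (k.+1%:R^-1)%:E.
  rewrite (le_trans _ (ltW (svalP (cid (F k))).2))//.
  apply: measure_sigma_subadditive => //.
  exact: (cG k).1.
have mB : measurable (\bigcap_k G k) by exact: bigcapT_measurable.
exists (\bigcap_k G k); split => //.
  exact: sub_bigcap.
apply/eqP; rewrite eq_le; apply/andP; split; last first.
  by rewrite -leb_borelE//; apply: le_leb; exact: sub_bigcap.
apply/lee_addgt0Pr => _/posnumP[e].
near \oo => k.
apply: (@le_trans _ _ (leb A + k.+1%:R^-1%:E)).
  rewrite (le_trans _ (vG k))// le_measure ?inE//.
  exact: bigcap_inf.
rewrite leeD2l// lee_fin; apply: ltW.
by near: k; exact: near_infty_natSinv_lt.
Unshelve. all: by end_near. Qed.

Lemma leb_negligible_hull (N : set Rn) : leb.-negligible N ->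
  exists B, [/\ measurable B, N `<=` B & vol B = 0].
Proof.
move=> [A [mA A0 NA]]; have [B [mB AB B0]] := borel_hull A.
by exists B; split => //; [exact: subset_trans AB|rewrite B0 A0].
Qed.

(** A hull of a set of infinite measure may exceed it by more than a null set,
so hulls are taken of its intersections with the sets of a countable cover of
the space by sets of finite measure. *)
Lemma borel_outer (A : set L) : measurable A ->
  exists B : set Rn, [/\ measurable B, A `<=` B & leb.-negligible (B `\` A)].
Proof.
move=> mA; have [S ST SS] := leb_sigma_finite.
have [B hB] : {B : nat -> set Rn & forall k, [/\ measurable (B k),
    A `&` S k `<=` B k & vol (B k) = leb (A `&` S k)]}.
  exists (fun k => sval (cid (borel_hull (A `&` S k)))) => k.
  by case: cid.
exists (\bigcup_k B k); split.
- by apply: bigcupT_measurable => k; have [] := hB k.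
- move=> x Ax; have [k _ Sk] : (\bigcup_k S k) x by rewrite -ST.
  by exists k => //; have [_ + _] := hB k; apply.
- suff : leb.-negligible (\bigcup_k (B k `\` (A `&` S k))).
    apply: negligibleS.
    move=> x [[k _ Bk] NAx]; exists k => //; split => // -[]//.
  apply: negligible_bigcup => k; have [mB AB vB] := hB k.
  have mAS : measurable (A `&` S k) by apply: measurableI => //; exact: (SS k).1.
  have mBL := borel_leb_measurable mB.
  apply/negligibleP; first exact: measurableD.
  have fAS : leb (A `&` S k) < +oo.
    rewrite (le_lt_trans _ (SS k).2)//; apply: le_leb; exact: subIsetr.
  have lB : leb (B k) = leb (A `&` S k) by rewrite leb_borelE.
  transitivity (leb (B k) - leb (B k `&` (A `&` S k))).
    by apply: measureD => //; move: fAS; rewrite -lB.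
  by rewrite (setIidr AB) lB subee// ge0_fin_numE// mu_ext_ge0.
Qed.

(** For each rational [r], the set [f > r] differs from a Borel set by a null
set. Off a Borel null set [N] that contains all these differences, the sets [f
> r] are Borel, hence so is [f]. *)
Lemma borel_representative (f : Rn -> \bar R) : lebesgue_measurable f ->
  exists (N : set Rn) (g : Rn -> R), [/\ measurable N, vol N = 0,
    measurable_fun setT g & forall x, ~ N x -> f x = (g x)%:E].
Proof.
move=> [mf ff].
pose A (r : rat) : set L := [set x | (ratr r)%:E < f x].
have mA r : measurable (A r).
  rewrite -[A r]setTI.
  have -> : A r = f @^-1` `](ratr r)%:E, +oo[%classic.
    by apply/seteqP; split => x; rewrite /= in_itv/= ?andbT//.
  exact/mf/emeasurable_itv.
have hB r : exists B : set Rn, [/\ measurable B, A r `<=` B & leb.-negligible (B `\` A r)].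
  exact: borel_outer.
pose B r := sval (cid (hB r)).
have mB r : measurable (B r) by rewrite /B; case: cid => ? [].
have AB r : A r `<=` B r by rewrite /B; case: cid => ? [].
have nB r : leb.-negligible (B r `\` A r) by rewrite /B; case: cid => ? [].
(* Collect the exceptional sets of all rational levels and the points where [f]
   is infinite. *)
have /leb_negligible_hull[N [mN BN N0]] : leb.-negligible
   ((\bigcup_k (if unpickle k is Some r then B r `\` A r else set0)) `|`
    ~` [set x | f x \is a fin_num]).
  apply: negligibleU => //; apply: negligible_bigcup => k.
  by case: unpickle => [r|]; [exact: nB|exact: negligible_set0].
have NB r x : ~ N x -> B r x -> A r x.
  move=> Nx Brx; apply: contrapT => Arx; apply: Nx; apply: BN; left.
  by exists (pickle r); [exact: I|rewrite pickleK].
have Nf x : ~ N x -> f x \is a fin_num.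
  by move=> Nx; apply: contrapT => fx; apply: Nx; apply: BN; right.
exists N, (fun x => if x \in N then 0%R else fine (f x)); split => //; last first.
  by move=> x Nx; rewrite memNset// fineK// Nf.
apply: (measurability _ (RGenOInfty.measurableE R)) => // _ [_ [c ->] <-].
rewrite setTI.
have -> : (fun x => if x \in N then 0%R else fine (f x)) @^-1` `]c, +oo[%classic =
   (N `&` [set x | (c < 0)%R]) `|`
   (~` N `&` \bigcup_(r : rat) (if (c < ratr r)%R then B r else set0)).
  apply/seteqP; split => x /=; rewrite in_itv/= andbT.
    case: ifPn => [/set_mem Nx c0|]; first by left.
    rewrite notin_setE => Nx cf; right; split => //.
    have /rat_in_itvoo[r] := cf; rewrite in_itv/= => /andP[cr rf].
    exists r => //; rewrite cr; apply: AB.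
    by rewrite /A/= -(fineK (Nf _ Nx)) lte_fin.
  move=> [[Nx c0]|[Nx [r _]]]; first by rewrite mem_set.
  case: ifPn => // cr /(NB _ _ Nx); rewrite memNset// /A/= -{1}(fineK (Nf _ Nx)) lte_fin.
  exact: lt_trans.
apply: measurableU; apply: measurableI => //.
- have [c0|c0] := pselect (c < 0)%R.
    by rewrite (_ : [set _ | _] = setT)//; apply/seteqP; split.
  by rewrite (_ : [set _ | _] = set0)//; apply/seteqP; split.
- exact: measurableC.
- by apply: bigcupT_measurable_rat => r; case: ifP.
Qed.

Lemma measurable_id_leb : measurable_fun [set: L] (fun x : L => x : Rn).
Proof. by move=> _ Y mY; rewrite setTI; exact: borel_leb_measurable. Qed.

Lemma borel_measurable_leb d (T : measurableType d) (h : Rn -> T) : measurable_fun setT h ->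
  measurable_fun [set: L] h.
Proof.
by move=> mh; exact: (measurableT_comp mh measurable_id_leb).
Qed.

Lemma ge0_integral_leb_borel (D : set Rn) (h : Rn -> \bar R) : measurable D ->
  measurable_fun setT h -> (forall x, 0 <= h x) ->
  \int[leb]_(x in D) h x = \int[vol]_(x in D) h x.
Proof.
move=> mD mh h0.
transitivity (\int[pushforward leb (fun x : L => x : Rn)]_(x in D) h x).
  rewrite (ge0_integral_pushforward measurable_id_leb)//.
  exact: measurable_funTS.
apply: (@eq_measure_integral _ _ _ D vol (measure_function_pushforward__canonical__measure_function_Measure leb measurable_id_leb)) => A mA _.
exact: leb_borelE.
Qed.

Lemma integral_leb_borel (D : set Rn) (h : Rn -> \bar R) : measurable D ->
  measurable_fun setT h -> 
  \int[leb]_(x in D) h x = \int[vol]_(x in D) h x.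
Proof.
move=> mD mh; rewrite integralE [RHS]integralE; congr (_ - _);
  apply: ge0_integral_leb_borel => //.
  exact: measurable_funepos.
exact: measurable_funeneg.
Qed.

End completion.

(** * Iterated integrals and Jensen's inequality *)

Section double_integral.
Context d (T : measurableType d) (R : realType).
Variable mu : {sigma_finite_measure set T -> \bar R}.
Variable Q : set T.
Hypothesis mQ : measurable Q.
Implicit Types F G : T * T -> \bar R.

Lemma measurable_section F x : measurable_fun setT F ->
  measurable_fun setT (fun y => F (x, y)).
Proof. by move=> mF; exact: (measurableT_comp mF). Qed.

Lemma measurable_inner_integral F : measurable_fun setT F ->
  (forall z, 0 <= F z) ->
  measurable_fun setT (fun x => \int[mu]_(y in Q) F (x, y)).
Proof.
move=> mF F0.
have -> : (fun x => \int[mu]_(y in Q) F (x, y)) =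
          fubini_F mu (F \_ ([set: T] `*` Q)).
  apply/funext => x; rewrite integral_mkcond; apply: eq_integral => y _.
  by rewrite !patchE in_setX in_setT.
apply: measurable_fun_fubini_tonelli_F.
  apply/(measurable_restrictT _ _).1; first exact: measurableX.
  exact: measurable_funTS.
by move=> z; rewrite patchE; case: ifP.
Qed.

Lemma iintC F : measurable_fun setT F -> (forall z, 0 <= F z) ->
  \int[mu]_(x in Q) \int[mu]_(y in Q) F (x, y) =
  \int[mu]_(x in Q) \int[mu]_(y in Q) F (y, x).
Proof.
move=> mF F0; pose G := F \_ (Q `*` Q).
have mG : measurable_fun setT G.
  apply/(measurable_restrictT _ _).1; first exact: measurableX.
  exact: measurable_funTS.
have G0 z : 0 <= G z by rewrite /G patchE; case: ifP.
transitivity (\int[mu]_x \int[mu]_y G (x, y)).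
  rewrite integral_mkcond; apply: eq_integral => x _; rewrite patchE.
  case: ifPn => xQ.
    rewrite integral_mkcond; apply: eq_integral => y _.
    by rewrite /G !patchE in_setX xQ.
  by rewrite integral0_eq// => y _; rewrite /G patchE in_setX (negbTE xQ).
rewrite (fubini_tonelli (m1 := mu) (m2 := mu) G)//.
rewrite [RHS]integral_mkcond; apply: eq_integral => x _; rewrite patchE.
case: ifPn => xQ.
  rewrite [RHS]integral_mkcond; apply: eq_integral => y _.
  by rewrite /G !patchE in_setX xQ andbT.
by rewrite integral0_eq// => y _; rewrite /G patchE in_setX (negbTE xQ) andbF.
Qed.

Lemma le_iint F G : measurable_fun setT F -> (forall z, 0 <= F z) ->
  measurable_fun setT G -> 
  (forall x y, Q x -> Q y -> F (x, y) <= G (x, y)) ->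
  (forall z, 0 <= G z) ->
  \int[mu]_(x in Q) \int[mu]_(y in Q) F (x, y) <=
  \int[mu]_(x in Q) \int[mu]_(y in Q) G (x, y).
Proof.
move=> mF F0 mG FG G0; apply: ge0_le_integral => //.
- by move=> x _; exact: integral_ge0.
- by apply: measurable_funTS; exact: measurable_inner_integral.
- by apply: measurable_funTS; exact: measurable_inner_integral.
- move=> x Qx; apply: ge0_le_integral => //.
  + by apply: measurable_funTS; exact: measurable_section.
  + by apply: measurable_funTS; exact: measurable_section.
  + by move=> y Qy; exact: FG.
Qed.

Lemma iintD F G : measurable_fun setT F -> (forall z, 0 <= F z) ->
  measurable_fun setT G -> (forall z, 0 <= G z) ->
  \int[mu]_(x in Q) \int[mu]_(y in Q) (F (x, y) + G (x, y)) =
  \int[mu]_(x in Q) \int[mu]_(y in Q) F (x, y) +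
  \int[mu]_(x in Q) \int[mu]_(y in Q) G (x, y).
Proof.
move=> mF F0 mG G0; rewrite -ge0_integralD//.
- apply: eq_integral => x _; rewrite ge0_integralD//.
  + by apply: measurable_funTS; exact: measurable_section.
  + by apply: measurable_funTS; exact: measurable_section.
- by move=> x _; exact: integral_ge0.
- by apply: measurable_funTS; exact: measurable_inner_integral.
- by move=> x _; exact: integral_ge0.
- by apply: measurable_funTS; exact: measurable_inner_integral.
Qed.

Lemma iintZ (c : R) F : (0 <= c)%R -> measurable_fun setT F ->
  (forall z, 0 <= F z) ->
  \int[mu]_(x in Q) \int[mu]_(y in Q) (c%:E * F (x, y)) =
  c%:E * \int[mu]_(x in Q) \int[mu]_(y in Q) F (x, y).
Proof.
move=> c0 mF F0; rewrite -ge0_integralZl_EFin//.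
- apply: eq_integral => x _; rewrite ge0_integralZl_EFin//.
  by apply: measurable_funTS; exact: measurable_section.
- by move=> x _; exact: integral_ge0.
- by apply: measurable_funTS; exact: measurable_inner_integral.
Qed.

End double_integral.

Section jensen.
Context d (T : measurableType d) (R : realType) (mu : {measure set T -> \bar R}).

Lemma integral_cst_le (D : set T) (c : \bar R) (h : T -> \bar R) :
  measurable D -> measurable_fun setT h -> (forall x, 0 <= h x) ->
  0 <= c -> (forall x, D x -> c <= h x) -> c * mu D <= \int[mu]_(x in D) h x.
Proof.
move=> mD mh h0 c0 ch; rewrite -integral_cst//.
by apply: ge0_le_integral => //; exact: measurable_funTS.
Qed.

(** With [a] the modulus of the mean of [h], integrate the tangent inequality
at [a] over [D]: its linear term is at least [q * a ^ q * v], because the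
integral of [|h|] is at least [a * v]. *)
Lemma jensen_powR (D : set T) (v q : R) (h : T -> R) :
  measurable D -> mu D = v%:E -> (0 < v)%R -> (1 <= q)%R ->
  mu.-integrable D (EFin \o h) -> measurable_fun setT h ->
  ((`|fine (\int[mu]_(x in D) (h x)%:E)| / v) `^ q)%:E <=
  (v^-1)%:E * \int[mu]_(x in D) (`|h x| `^ q)%:E.
Proof.
move=> mD Dv v0 q1 ih mh.
set m := fine _; set a := (`|m| / v)%R.
set I := \int[mu]_(x in D) (`|h x| `^ q)%:E.
have I0 : 0 <= I by apply: integral_ge0 => x _; rewrite lee_fin powR_ge0.
have [a0|a0] := eqVneq a 0%R.
  rewrite a0 powR0 ?gt_eqF//; last lra.
  by rewrite mule_ge0// lee_fin invr_ge0 ltW.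
have {}a0 : (0 < a)%R by rewrite lt0r a0 divr_ge0// ltW.
have mfin : \int[mu]_(x in D) (h x)%:E = m%:E.
  by rewrite fineK//; exact: integrable_fin_num.
have mhn : measurable_fun setT (fun x => `|h x|%R) by exact: measurableT_comp.
have mhq : measurable_fun setT (fun x => `|h x| `^ q)%R.
  exact: (measurableT_comp (measurable_powR q) mhn).
have : (q * a `^ (q - 1))%:E * \int[mu]_(x in D) (`|h x|)%:E <=
       I + ((q - 1) * a `^ q * v)%:E.
  have c0 : (0 <= (q - 1) * a `^ q)%R by rewrite mulr_ge0 ?powR_ge0//; lra.
  rewrite -ge0_integralZl_EFin//; last 2 first.
  - by apply/measurable_EFinP; exact: measurable_funTS.
  - by rewrite mulr_ge0 ?powR_ge0//; lra.
  rewrite (EFinM _ v) -Dv -integral_cst// -ge0_integralD//; last first.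
    by apply/measurable_EFinP; exact: measurable_funTS.
  apply: ge0_le_integral => //.
  - by move=> x _; rewrite -EFinM lee_fin !mulr_ge0 ?powR_ge0//; lra.
  - apply: measurable_funTS; apply/measurable_EFinP; exact: measurable_funM.
  - apply: measurable_funTS; apply/measurable_EFinP; exact: measurable_funD.
  - by move=> x _; rewrite -EFinM -EFinD lee_fin young_tangent.
have am : (a * v)%:E <= \int[mu]_(x in D) (`|h x|)%:E.
  rewrite /a divfK ?gt_eqF// -[`|m|%:E]/(`|m%:E|) -mfin.
  apply: le_abse_integral => //.
  by apply/measurable_EFinP; exact: measurable_funTS.
have [->|Ifin] := eqVneq I +oo.
  by rewrite gt0_muley ?leey// lte_fin invr_gt0.
have {Ifin} : I = (fine I)%:E by rewrite fineK// ge0_fin_numE ?ltey.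
set r := fine I => -> h1.
have c1 : (0 <= q * a `^ (q - 1))%R by rewrite mulr_ge0 ?powR_ge0//; lra.
have := le_trans (lee_wpmul2l _ am) h1; rewrite lee_fin => /(_ c1).
rewrite -EFinM -EFinD !lee_fin => h2.
have aq : (a * a `^ (q - 1) = a `^ q)%R by rewrite mulr_powRB1// ?ltW//; lra.
rewrite mulrC ler_pdivlMr//.
have : (q * a `^ (q - 1) * (a * v) = q * (a `^ q * v))%R by rewrite -aq; ring.
lra.
Qed.

End jensen.

(** * The energy of a cube *)

Section energy.
Context {R : realType} {n : nat}.
Hypothesis n0 : (0 < n)%N.
Notation Rn := 'rV[R]_n.
Implicit Types (q s l : R) (g : Rn -> R) (Q : set Rn).

(** The value at [x = y] is [0] for [q > 0], since the first factor vanishes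
there. *)
Definition osc q s g (z : Rn * Rn) : R :=
  (`|g z.1 - g z.2| `^ q * (euclid_dist z.1 z.2 `^ s)^-1)%R.

Definition energy q s g Q : \bar R :=
  \int[vol]_(x in Q) \int[vol]_(y in Q) (osc q s g (x, y))%:E.

Lemma osc_ge0 q s g z : (0 <= osc q s g z)%R.
Proof. by rewrite mulr_ge0 ?invr_ge0 ?powR_ge0. Qed.

Lemma measurable_diffq q g : measurable_fun setT g ->
  measurable_fun setT (fun z : Rn * Rn => `|g z.1 - g z.2| `^ q)%R.
Proof.
move=> mg.
have m1 : measurable_fun setT (fun z : Rn * Rn => `|g z.1 - g z.2|)%R.
  apply: measurableT_comp => //.
  by apply: measurable_funB; apply: measurableT_comp.
exact: (measurableT_comp (measurable_powR q) m1).
Qed.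

Lemma measurable_dist_kernel s :
  measurable_fun setT (fun z : Rn * Rn => (euclid_dist z.1 z.2 `^ s)^-1)%R.
Proof.
under eq_fun do rewrite -powRN.
exact: (measurableT_comp (measurable_powR (- s)) measurable_euclid_dist).
Qed.

Lemma measurable_osc q s g : measurable_fun setT g ->
  measurable_fun setT (fun z => (osc q s g z)%:E).
Proof.
move=> mg; apply/measurable_EFinP; apply: measurable_funM.
  exact: measurable_diffq.
exact: measurable_dist_kernel.
Qed.

Lemma osc_eq0 q s g x y : (0 < q)%R -> osc q s g (x, y) = 0%R -> g x = g y.
Proof.
move=> q0 /eqP; rewrite mulf_eq0 invr_eq0 => /orP[|] /eqP /powR_eq0_eq0.
  by move=> /eqP; rewrite normr_eq0 subr_eq0 => /eqP.
by move=> /euclid_dist_eq0 /= ->.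
Qed.

Lemma measurable_cube l Q : (0 < l)%R -> cube l Q -> measurable Q.
Proof. by move=> l0 /(vol_cube l0)[]. Qed.

Lemma osc_exponent_le q s1 s2 g l Q x y : (0 < q)%R -> (0 < l)%R -> cube l Q ->
  (s1 <= s2)%R -> Q x -> Q y ->
  (osc q s1 g (x, y) <= (n%:R * l) `^ (s2 - s1) * osc q s2 g (x, y))%R.
Proof.
move=> q0 l0 cQ s12 Qx Qy; rewrite /osc/=.
have [->|xy] := eqVneq x y.
  by rewrite subrr normr0 powR0 ?gt_eqF// !mul0r mulr0.
have d0 : (0 < euclid_dist x y)%R.
  rewrite lt0r euclid_dist_ge0 andbT; apply: contra xy => /eqP.
  by move=> /euclid_dist_eq0 ->.
rewrite mulrCA; apply: ler_wpM2l; first exact: powR_ge0.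
rewrite ler_pdivlMr ?powR_gt0// mulrC -powRB; last by rewrite (gt_eqF d0) implybT.
apply: ge0_ler_powR; rewrite ?nnegrE ?subr_ge0 ?euclid_dist_ge0 ?mulr_ge0 ?(ltW l0)//.
apply: euclid_dist_le => //; first exact: ltW.
exact: (cube_coord_le cQ).
Qed.

Lemma energy_exponent_le q s1 s2 g l Q : (0 < q)%R -> measurable_fun setT g ->
  (0 < l)%R -> cube l Q -> (s1 <= s2)%R ->
  energy q s1 g Q <= ((n%:R * l) `^ (s2 - s1))%:E * energy q s2 g Q.
Proof.
move=> q0 mg l0 cQ s12; have mQ := measurable_cube l0 cQ.
rewrite /energy.
rewrite -(iintZ (@vol R n) mQ (F := fun z => (osc q s2 g z)%:E))//; last 3 first.
- exact: powR_ge0.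
- exact: measurable_osc.
- by move=> z; rewrite lee_fin osc_ge0.
apply: (le_iint (@vol R n) mQ (F := fun z => (osc q s1 g z)%:E)
  (G := fun z => ((n%:R * l) `^ (s2 - s1))%:E * (osc q s2 g z)%:E)).
- exact: measurable_osc.
- by move=> z; rewrite lee_fin osc_ge0.
- by apply: measurable_funeM; exact: measurable_osc.
- by move=> x y Qx Qy; rewrite -EFinM lee_fin (osc_exponent_le _ _ l0 cQ).
- by move=> z; rewrite -EFinM lee_fin mulr_ge0 ?powR_ge0 ?osc_ge0.
Qed.

(** Each of the two removed cubes has edge [l / 4], hence at most a quarter of
the volume of [Q]. *)
Lemma vol_far_le l Q x y : (0 < l)%R -> cube l Q ->
  let Z := Q `\` (centred_cube x (l / 8) `|` centred_cube y (l / 8)) in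
  measurable Z /\ ((l ^+ n) / 2)%:E <= vol Z.
Proof.
move=> l0 cQ Z; have [mQ vQ] := vol_cube l0 cQ.
have l8 : (0 < 2 * (l / 8))%R by lra.
have [mX vX] := vol_cube l8 (centred_cubeP x (l / 8)).
have [mY vY] := vol_cube l8 (centred_cubeP y (l / 8)).
have mZ : measurable Z by apply: measurableD => //; exact: measurableU.
split => //.
have : vol Q <= vol Z + (vol (centred_cube x (l / 8)) + vol (centred_cube y (l / 8))).
  apply: (@le_trans _ _ (vol (Z `|` (centred_cube x (l / 8) `|` centred_cube y (l / 8))))).
    apply: le_measure; rewrite ?inE//; first by apply: measurableU => //; exact: measurableU.
    by rewrite /Z setDE; move=> z Qz; have [|] := pselect ((centred_cube x (l / 8) `|` centred_cube y (l / 8)) z); [right|left].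
  apply: (le_trans (measureU2 _ _ _)) => //; first exact: measurableU.
  by apply: leeD2l; exact: measureU2.
rewrite vQ vX vY.
have Zfin : vol Z \is a fin_num.
  rewrite ge0_fin_numE//; apply: (@le_lt_trans _ _ (vol Q)); last by rewrite vQ ltry.
  by apply: le_measure; rewrite ?inE//; exact: subDsetl.
rewrite -(fineK Zfin) -!EFinD !lee_fin => h.
(* The dimension is positive, so the factor [4 ^ - n] is at most [1 / 4]. *)
have h4 : ((2 * (l / 8)) ^+ n <= l ^+ n / 4)%R.
  rewrite (_ : 2 * (l / 8) = l * 4^-1)%R; last lra.
  rewrite exprMn; apply: ler_wpM2l; first by rewrite exprn_ge0 ?(ltW l0).
  by rewrite ler_iXnr ?invr_ge0// invf_le1//; lra.
lra.
Qed.

(** Go from [x] to [y] through an intermediate point [z] of [Q] that stays at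
distance at least [l / 8] from both, so that the kernel is at least a constant
times its value at distance [l]; then integrate over all such [z]. *)
Lemma diffq_le_inner q s : (1 <= q)%R -> exists2 C, (0 < C)%R &
  forall g l Q x y, measurable_fun setT g -> (0 < l)%R -> cube l Q ->
    Q x -> Q y ->
  (`|g x - g y| `^ q)%:E <= (C * l `^ s / l ^+ n)%:E *
    (\int[vol]_(z in Q) (osc q s g (x, z))%:E +
     \int[vol]_(z in Q) (osc q s g (y, z))%:E).
Proof.
move=> q1; have N1 : (1 <= 8 * n%:R :> R)%R.
  have : (1 <= n%:R :> R)%R by rewrite ler1n.
  lra.
have [c c0 hc] := powR_comparable s N1.
exists (2 * 2 `^ (q - 1) / c)%R; first by rewrite !mulr_gt0 ?powR_gt0 ?invr_gt0.
move=> g l Q x y mg l0 cQ Qx Qy.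
have [mQ _] := vol_cube l0 cQ.
have [] := vol_far_le x y l0 cQ; set Z := _ `\` _ => mZ vZ.
have ln0 : (0 < l ^+ n)%R by rewrite exprn_gt0.
have ls0 : (0 < l `^ s)%R by rewrite powR_gt0.
have mosc w : measurable_fun setT (fun z => (osc q s g (w, z))%:E).
  apply: (measurable_section (F := fun z => (osc q s g z)%:E)).
  exact: measurable_osc.
have far w z : Q w -> Q z -> ~ centred_cube w (l / 8) z ->
    (c / l `^ s <= (euclid_dist w z `^ s)^-1)%R.
  move=> Qw Qz /far_centred_cube wz; apply: hc => //.
    apply: le_trans wz; rewrite ler_pM2l// lef_pV2 ?posrE// ?mulr_gt0 ?ltr0n//.
    have : (1 <= n%:R :> R)%R by rewrite ler1n.
    lra.
  apply: (@le_trans _ _ (n%:R * l)%R).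
    apply: euclid_dist_le => //; first exact: ltW.
    exact: (cube_coord_le cQ).
  by apply: ler_wpM2r; [exact: ltW|rewrite ler_peMl// ler1n].
set k := (c / l `^ s * `|g x - g y| `^ q)%R.
have k0 : (0 <= k)%R by rewrite mulr_ge0 ?powR_ge0// divr_ge0 ?ltW.
pose F z := (2 `^ (q - 1))%:E * ((osc q s g (x, z))%:E + (osc q s g (y, z))%:E).
have mF : measurable_fun setT F by apply: measurable_funeM; exact: emeasurable_funD.
have F0 z : 0 <= F z.
  by rewrite mule_ge0 ?adde_ge0// lee_fin ?powR_ge0 ?osc_ge0.
have kF z : Z z -> k%:E <= F z.
  move=> [Qz /not_orP[xz yz]]; rewrite /F -EFinD -EFinM lee_fin /k /osc/=.
  apply: (@le_trans _ _ (c / l `^ s * (2 `^ (q - 1) * (`|g x - g z| `^ q + `|g z - g y| `^ q)))%R).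
    apply: ler_wpM2l; first by rewrite divr_ge0 ?ltW.
    exact: powR_dist_le.
  rewrite mulrCA; apply: ler_wpM2l; first exact: powR_ge0.
  rewrite mulrDr; apply: lerD.
    by rewrite mulrC; apply: ler_wpM2l; [exact: powR_ge0|exact: far].
  rewrite (distrC (g z)) mulrC; apply: ler_wpM2l; first exact: powR_ge0.
  exact: far.
have h1 : k%:E * ((l ^+ n) / 2)%:E <= \int[vol]_(z in Q) F z.
  apply: (@le_trans _ _ (k%:E * vol Z)); first by rewrite lee_wpmul2l// lee_fin.
  apply: (@le_trans _ _ (\int[vol]_(z in Z) F z)).
    by apply: integral_cst_le => //; rewrite lee_fin.
  apply: ge0_subset_integral => //; first exact: measurable_funTS.
  by rewrite /Z; exact: subDsetl.
have IF : \int[vol]_(z in Q) F z = (2 `^ (q - 1))%:E *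
  (\int[vol]_(z in Q) (osc q s g (x, z))%:E + \int[vol]_(z in Q) (osc q s g (y, z))%:E).
  rewrite ge0_integralZl_EFin ?powR_ge0//; last 2 first.
  - by move=> z _; rewrite adde_ge0// lee_fin osc_ge0.
  - by apply: measurable_funTS; exact: emeasurable_funD.
  rewrite ge0_integralD//.
  - by move=> z _; rewrite lee_fin osc_ge0.
  - by apply: measurable_funTS.
  - by move=> z _; rewrite lee_fin osc_ge0.
  - by apply: measurable_funTS.
rewrite IF in h1.
have kk : (0 <= 2 * l `^ s / (c * l ^+ n))%R.
  by rewrite divr_ge0 ?mulr_ge0 ?ltW.
have := lee_wpmul2l _ h1 => /(_ (2 * l `^ s / (c * l ^+ n))%:E).
rewrite lee_fin => /(_ kk); rewrite !muleA -!EFinM.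
congr (_%:E <= _%:E * _).
  by rewrite /k; move: ln0 ls0; move: (l ^+ n)%R (l `^ s)%R => u v u0 v0;
    field; rewrite !gt_eqF.
by move: ln0 ls0; move: (l ^+ n)%R (l `^ s)%R (2 `^ (q - 1))%R => u v w u0 v0; field; rewrite !gt_eqF.
Qed.

End energy.

Lemma ae_exists d (T : measurableType d) (R : realType)
    (mu : {measure set T -> \bar R}) (Q : set T) (P : T -> Prop) :
  measurable Q -> mu Q != 0 -> {ae mu, forall x, P x} -> exists2 x, Q x & P x.
Proof.
move=> mQ Q0 aeP; apply: contrapT => nP; move/eqP: Q0; apply.
apply/(negligibleP mu mQ); apply: negligibleS aeP => x Qx /= Px.
by apply: nP; exists x.
Qed.

Section energy_lower.
Context {R : realType} {n : nat}.
Hypothesis n0 : (0 < n)%N.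
Notation Rn := 'rV[R]_n.
Implicit Types (q s l : R) (g : Rn -> R) (Q : set Rn).

Lemma integral_cst_cube l Q (r : \bar R) : (0 < l)%R -> cube l Q ->
  \int[vol]_(x in Q) r = r * (l ^+ n)%:E.
Proof.
move=> l0 cQ; have [mQ vQ] := vol_cube l0 cQ.
by rewrite -vQ; exact: (integral_cst (@vol R n) mQ).
Qed.

Lemma measurable_inner_osc q s g Q : measurable Q -> measurable_fun setT g ->
  measurable_fun setT (fun x => \int[vol]_(y in Q) (osc q s g (x, y))%:E).
Proof.
move=> mQ mg; apply: (measurable_inner_integral (@vol R n) mQ (F := fun z => (osc q s g z)%:E)).
  exact: measurable_osc.
by move=> z; rewrite lee_fin osc_ge0.
Qed.

Lemma inner_osc_ge0 q s g Q x : 0 <= \int[vol]_(y in Q) (osc q s g (x, y))%:E.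
Proof. by apply: integral_ge0 => y _; rewrite lee_fin osc_ge0. Qed.

Lemma energy_ge0 q s g Q : 0 <= energy q s g Q.
Proof. by apply: integral_ge0 => x _; exact: inner_osc_ge0. Qed.

Lemma le_energy q s g P Q : measurable P -> measurable Q ->
  measurable_fun setT g -> P `<=` Q -> energy q s g P <= energy q s g Q.
Proof.
move=> mP mQ mg PQ.
apply: (@le_trans _ _ (\int[vol]_(x in P) \int[vol]_(y in Q) (osc q s g (x, y))%:E)).
  apply: ge0_le_integral => //.
  - by move=> x _; exact: inner_osc_ge0.
  - by apply: measurable_funTS; exact: measurable_inner_osc.
  - by apply: measurable_funTS; exact: measurable_inner_osc.
  - move=> x _; apply: ge0_subset_integral => //.
      apply: measurable_funTS.
      apply: (measurable_section (F := fun z => (osc q s g z)%:E)).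
      exact: measurable_osc.
    by move=> y _; rewrite lee_fin osc_ge0.
apply: ge0_subset_integral => //.
  by apply: measurable_funTS; exact: measurable_inner_osc.
by move=> x _; exact: inner_osc_ge0.
Qed.

(** Integrate [diffq_le_inner] in both variables. *)
Lemma iint_diffq_le_energy q s : (1 <= q)%R -> exists2 C, (0 < C)%R &
  forall g l Q, measurable_fun setT g -> (0 < l)%R -> cube l Q ->
  \int[vol]_(x in Q) \int[vol]_(y in Q) (`|g x - g y| `^ q)%:E <=
  (C * l `^ s)%:E * energy q s g Q.
Proof.
move=> q1; have [C C0 hC] := diffq_le_inner n0 s q1.
exists (2 * C)%R => [|g l Q mg l0 cQ]; first exact: mulr_gt0.
have [mQ vQ] := vol_cube l0 cQ.
have ln0 : (0 < l ^+ n)%R by rewrite exprn_gt0.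
set K := (C * l `^ s / l ^+ n)%R.
have K0 : (0 <= K)%R.
  by rewrite divr_ge0 ?mulr_ge0 ?powR_ge0 ?(ltW C0) ?(ltW ln0).
pose H x := \int[vol]_(y in Q) (osc q s g (x, y))%:E.
have mH : measurable_fun setT H by exact: measurable_inner_osc.
have H0 x : 0 <= H x by exact: inner_osc_ge0.
have hCH x y : Q x -> Q y -> (`|g x - g y| `^ q)%:E <= K%:E * (H x + H y).
  by move=> Qx Qy; exact: hC.
have EH : \int[vol]_(x in Q) H x = energy q s g Q by [].
clearbody H.
have mH1 : measurable_fun setT (fun z : Rn * Rn => H z.1).
  exact: (measurableT_comp mH measurable_fst).
have mH2 : measurable_fun setT (fun z : Rn * Rn => H z.2).
  exact: (measurableT_comp mH measurable_snd).
apply: (@le_trans _ _ (\int[vol]_(x in Q) \int[vol]_(y in Q)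
    (K%:E * (H x + H y)))).
  apply: (le_iint (@vol R n) mQ (F := fun z => (`|g z.1 - g z.2| `^ q)%:E)
    (G := fun z => K%:E * (H z.1 + H z.2))).
  - by apply/measurable_EFinP; exact: measurable_diffq.
  - by move=> z; rewrite lee_fin powR_ge0.
  - by apply: measurable_funeM; exact: emeasurable_funD.
  - by move=> x y Qx Qy; exact: hCH.
  - by move=> z; rewrite mule_ge0 ?adde_ge0.
rewrite (iintZ (@vol R n) mQ (F := fun z => H z.1 + H z.2))//; last 2 first.
- exact: emeasurable_funD.
- by move=> z; rewrite adde_ge0.
rewrite (iintD (@vol R n) mQ (F := fun z => H z.1) (G := fun z => H z.2))//=.
have -> : \int[vol]_(x in Q) \int[vol]_(y in Q) H x = (l ^+ n)%:E * energy q s g Q.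
  under eq_integral do rewrite (integral_cst_cube _ l0 cQ).
  by rewrite ge0_integralZr//; [rewrite EH muleC|exact: measurable_funTS|rewrite lee_fin ltW].
have -> : \int[vol]_(x in Q) \int[vol]_(y in Q) H y = (l ^+ n)%:E * energy q s g Q.
  by rewrite (integral_cst_cube _ l0 cQ) EH muleC.
rewrite -ge0_muleDl ?lee_fin ?(ltW ln0)// -EFinD muleA -EFinM /K.
rewrite le_eqVlt; apply/orP; left; apply/eqP; congr (_%:E * _).
by move: ln0; move: (l ^+ n)%R (l `^ s)%R => u v u0; field; rewrite gt_eqF.
Qed.

(** Finite energy gives a point [x] of [Q] at which the inner integral is
finite; integrating [diffq_le_inner] in [y] bounds the integral of [|g x - g y|
^ q], which dominates [|g y|] up to a constant. *)
Lemma energy_lty_integrable q s g l Q : (1 <= q)%R -> measurable_fun setT g ->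
  (0 < l)%R -> cube l Q -> energy q s g Q < +oo ->
  (@vol R n).-integrable Q (EFin \o g).
Proof.
move=> q1 mg l0 cQ Efin; have [C C0 hC] := diffq_le_inner n0 s q1.
have [mQ vQ] := vol_cube l0 cQ.
pose K := (C * l `^ s / l ^+ n)%R.
have K0 : (0 <= K)%R.
  by rewrite divr_ge0 ?mulr_ge0 ?powR_ge0 ?exprn_ge0 ?(ltW C0) ?(ltW l0).
pose H x := \int[vol]_(y in Q) (osc q s g (x, y))%:E.
have mH : measurable_fun setT H by exact: measurable_inner_osc.
have H0 x : 0 <= H x by exact: inner_osc_ge0.
have hCH x y : Q x -> Q y -> (`|g x - g y| `^ q)%:E <= K%:E * (H x + H y).
  by move=> Qx Qy; exact: hC.
have EH : \int[vol]_(x in Q) H x = energy q s g Q by [].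
clearbody H K.
have iH : (@vol R n).-integrable Q H.
  apply/integrableP; split; first exact: measurable_funTS.
  by under eq_integral do rewrite gee0_abs//; rewrite EH.
have vQ0 : (@vol R n) Q != 0 by rewrite vQ eqe expf_eq0 gt_eqF// andbF.
have [x Qx /(_ Qx) Hx] := ae_exists mQ vQ0 (integrable_ae mQ iH).
have mg' : measurable_fun setT (fun y : Rn => `|g x - g y|%R).
  by apply: measurableT_comp => //; exact: measurable_funB.
have mh : measurable_fun setT (fun y : Rn => (`|g x - g y| `^ q)%R).
  exact: (measurableT_comp (measurable_powR q) mg').
have h1 : \int[vol]_(y in Q) (`|g x - g y| `^ q)%:E < +oo.
  apply: (@le_lt_trans _ _ (\int[vol]_(y in Q) (K%:E * (H x + H y)))).
    apply: ge0_le_integral => //.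
    - by apply: measurable_funTS; apply/measurable_EFinP.
    - by apply: measurable_funTS; apply: measurable_funeM; exact: emeasurable_funD.
    - by move=> y Qy; exact: hCH.
  rewrite ge0_integralZl_EFin//; last 2 first.
  - by move=> y _; rewrite adde_ge0.
  - by apply: measurable_funTS; exact: emeasurable_funD.
  rewrite ge0_integralD//; last exact: measurable_funTS.
  rewrite (integral_cst_cube _ l0 cQ) EH.
  have Ef : energy q s g Q \is a fin_num by rewrite ge0_fin_numE// energy_ge0.
  by rewrite ltey_eq fin_numM// fin_numD fin_numM.
apply/integrableP; split; first by apply: measurable_funTS; apply/measurable_EFinP.
apply: (@le_lt_trans _ _ (\int[vol]_(y in Q) ((`|g x| + 1)%:E + (`|g x - g y| `^ q)%:E))).
  apply: ge0_le_integral => //.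
  - apply: measurable_funTS; apply: measurableT_comp => //; exact/measurable_EFinP.
  - apply: measurable_funTS; apply: emeasurable_funD => //; exact/measurable_EFinP.
  - move=> y _; rewrite /= -EFinD lee_fin.
    have : (`|g y| <= `|g x| + `|g x - g y|)%R.
      by have := ler_normB (g x) (g x - g y)%R; rewrite subKr.
    suff : (`|g x - g y| <= 1 + `|g x - g y| `^ q)%R by lra.
    have [t1|t1] := leP 1%R `|g x - g y|%R.
      by rewrite (le_trans (le1r_powR t1 q1))// lerDr.
    by rewrite (le_trans (ltW t1))// lerDl powR_ge0.
rewrite ge0_integralD//; last first.
  by apply: measurable_funTS; apply/measurable_EFinP.
by rewrite (integral_cst_cube _ l0 cQ) lte_add_pinfty// -EFinM ltry.
Qed.

(** Jensen's inequality for [y |-> g x - g y], whose mean over [Q] is [g x]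
minus the mean of [g]. *)
Lemma mean_osc_le_iint q g l Q : (1 <= q)%R -> measurable_fun setT g ->
  (0 < l)%R -> cube l Q -> (@vol R n).-integrable Q (EFin \o g) ->
  \int[vol]_(x in Q)
    (`|g x - fine (\int[vol]_(y in Q) (g y)%:E) / l ^+ n| `^ q)%:E <=
  ((l ^+ n)^-1)%:E *
    \int[vol]_(x in Q) \int[vol]_(y in Q) (`|g x - g y| `^ q)%:E.
Proof.
move=> q1 mg l0 cQ ig; have [mQ vQ] := vol_cube l0 cQ.
have ln0 : (0 < l ^+ n)%R by rewrite exprn_gt0.
have mD : measurable_fun setT (fun z : Rn * Rn => (`|g z.1 - g z.2| `^ q)%:E).
  by apply/measurable_EFinP; exact: measurable_diffq.
have mI : measurable_fun setT (fun x => \int[vol]_(y in Q) (`|g x - g y| `^ q)%:E).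
  apply: (measurable_inner_integral (@vol R n) mQ mD).
  by move=> z; rewrite lee_fin powR_ge0.
rewrite -ge0_integralZl_EFin//; last 3 first.
- by move=> x _; apply: integral_ge0 => y _; rewrite lee_fin powR_ge0.
- exact: measurable_funTS.
- by rewrite invr_ge0 ltW.
set m := fine _.
apply: ge0_le_integral => //.
- apply: measurable_funTS; apply/measurable_EFinP.
  have mn : measurable_fun setT (fun x => `|g x - m / l ^+ n|)%R.
    by apply: measurableT_comp => //; exact: measurable_funB.
  exact: (measurableT_comp (measurable_powR q) mn).
- by apply: measurable_funTS; exact: measurable_funeM.
move=> x Qx.
have icst : (@vol R n).-integrable Q (EFin \o cst (g x)).
  apply/integrableP; split; first by apply/measurable_EFinP; exact: measurable_cst.
  by rewrite /= (integral_cst_cube _ l0 cQ) -EFinM ltry.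
have ih : (@vol R n).-integrable Q (EFin \o (fun y => g x - g y)%R).
  exact: (integrableB mQ icst ig).
have mh : measurable_fun setT (fun y => g x - g y)%R by exact: measurable_funB.
have := jensen_powR mQ vQ ln0 q1 ih mh.
congr (_ <= _); congr ((_ `^ _)%:E).
have -> : \int[vol]_(y in Q) (g x - g y)%:E =
    (g x * l ^+ n)%:E - \int[vol]_(y in Q) (g y)%:E.
  rewrite integralB_EFin//.
  by rewrite (integral_cst_cube _ l0 cQ) EFinM.
have /fineK <- : \int[vol]_(y in Q) (g y)%:E \is a fin_num.
  exact: integrable_fin_num.
rewrite -/m -EFinB /=.
have -> : (g x - m / l ^+ n = (g x * l ^+ n - m) / l ^+ n)%R.
  by rewrite mulrBl mulfK// gt_eqF.
by rewrite normrM normfV (gtr0_norm ln0).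
Qed.

End energy_lower.

(** * Vanishing energy and the integral of the kernel *)

Lemma exists_half_pow_lt {R : realType} (l d : R) : (0 <= l)%R -> (0 < d)%R ->
  exists k : nat, (l * 2^-1 ^+ k < d)%R.
Proof.
move=> l0 d0; exists (Num.bound (l / d)).
have hb := archi_boundP (divr_ge0 l0 (ltW d0)); set N := Num.bound _ in hb *.
rewrite exprVn ltr_pdivrMr ?exprn_gt0//.
move: hb; rewrite ltr_pdivrMr// => /lt_le_trans; apply.
by rewrite mulrC ler_pM2l// -natrX ler_nat ltnW// ltn_expl.
Qed.

Section energy_const.
Context {R : realType} {n : nat}.
Hypothesis n0 : (0 < n)%N.
Notation Rn := 'rV[R]_n.
Implicit Types (q s l : R) (g : Rn -> R) (Q : set Rn).

(** Almost every [x0] in the smallest cube has vanishing inner integral on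
every cube of the exhaustion, so [g y = g x0] for almost every [y]. *)
Lemma energy_eq0_ae_const q s g : (0 < q)%R -> measurable_fun setT g ->
  (forall k, energy q s g (centred_cube 0 k.+1%:R) = 0) ->
  exists c, {ae (@vol R n), forall x, g x = c}.
Proof.
move=> q0 mg E0.
pose Q k : set Rn := centred_cube 0 k.+1%:R.
have cQ k : (0 < 2 * k.+1%:R :> R)%R /\ cube (2 * k.+1%:R) (Q k).
  by split; [rewrite mulr_gt0|exact: centred_cubeP].
have mQ k : measurable (Q k) by have [l0 /(vol_cube l0)[]] := cQ k.
have QQ k : Q 0%N `<=` Q k.
  move=> x Qx i; have := Qx i; rewrite mxE !in_itv/= => /andP[h1 h2].
  have : (1 <= k.+1%:R :> R)%R by rewrite ler1n.
  by move=> k1; apply/andP; split; lra.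
have aeH : {ae (@vol R n), forall x, forall k, Q k x ->
    \int[vol]_(y in Q k) (osc q s g (x, y))%:E = 0}.
  apply/ae_foralln => k.
  have mH := measurable_inner_osc q s (mQ k) mg.
  apply/(ae_eq_integral_abs _ (mQ k)); first exact: measurable_funTS.
  under eq_integral do rewrite gee0_abs ?inner_osc_ge0//.
  exact: (E0 k).
have vQ0 : (@vol R n) (Q 0%N) != 0.
  have [l0 /(vol_cube l0)[_ ->]] := cQ 0%N.
  by rewrite eqe expf_eq0 (gt_eqF l0) andbF.
have [x0 Qx0 Hx0] := ae_exists (mQ 0%N) vQ0 aeH.
exists (g x0).
have mosc : measurable_fun setT (fun z => (osc q s g (x0, z))%:E).
  apply: (measurable_section (F := fun z => (osc q s g z)%:E)).
  exact: measurable_osc.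
have : {ae (@vol R n), forall y, forall k, Q k y -> (osc q s g (x0, y))%:E = 0}.
  apply/ae_foralln => k.
  apply/(ae_eq_integral_abs _ (mQ k)); first exact: measurable_funTS.
  under eq_integral do rewrite gee0_abs ?lee_fin ?osc_ge0//.
  exact: (Hx0 k (QQ k _ Qx0)).
apply: filterS => y Hy; have [k Qky] := exists_centred_cube y.
by have [/(osc_eq0 q0)] := Hy k Qky.
Qed.

Lemma nneseries_geometric_le (a z : R) : (0 <= a)%R -> (0 <= z < 1)%R ->
  \sum_(k <oo) (a * z ^+ k)%:E <= (a / (1 - z))%:E.
Proof.
move=> a0 /andP[z0 z1]; apply: lime_le.
  by apply: is_cvg_nneseries => k _ _; rewrite lee_fin mulr_ge0 ?exprn_ge0.
apply: nearW => N; rewrite sumEFin lee_fin -mulr_sumr; apply: ler_wpM2l => //.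
rewrite big_mkord -[leRHS]mul1r ler_pdivlMr ?subr_gt0//.
have := subrX1 z N; have : (0 <= z ^+ N)%R by rewrite exprn_ge0.
set S := (\sum_(i < N) _)%R; nra.
Qed.

Lemma nneseries_term_le (u : nat -> \bar R) k : (forall i, 0 <= u i) ->
  u k <= \sum_(i <oo) u i.
Proof.
move=> u0; apply: (@le_trans _ _ (\sum_(0 <= i < k.+1) u i)).
  by rewrite big_nat_recr//= leeDr// sume_ge0.
exact: nneseries_lim_ge.
Qed.

Lemma centred_cube_norm (x y : Rn) r :
  centred_cube x r y <-> forall i, (`|x ord0 i - y ord0 i| <= r)%R.
Proof. by split => h i; have := h i; rewrite in_itv/= ler_distlC. Qed.

(** The first halving of the cube centred at [x] that leaves [y] outside
locates the dyadic shell of [y]. *)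
Lemma exists_shell (x y : Rn) l : (0 < l)%R -> x != y -> centred_cube x l y ->
  exists k : nat, centred_cube x (l * 2^-1 ^+ k) y /\
    ~ centred_cube x (l * 2^-1 ^+ k.+1) y.
Proof.
move=> l0 xy xly.
have /existsNP[N hN] : ~ forall k, centred_cube x (l * 2^-1 ^+ k) y.
  move=> h; move/eqP: xy; apply; apply/rowP => i; apply/eqP.
  rewrite -subr_eq0 -normr_eq0; apply: contrapT => /negP d0.
  have [|k] := @exists_half_pow_lt _ l `|x ord0 i - y ord0 i|%R (ltW l0).
    by rewrite lt0r d0 /=.
  by rewrite ltNge (centred_cube_norm x y _).1.
have [m] := ex_minnP (ex_intro (fun k => `[< ~ centred_cube x (l * 2^-1 ^+ k) y >]) N (asboolT hN)).
case: m => [/asboolP|m /asboolP mP min].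
  by rewrite expr0 mulr1.
exists m; split => //; apply: contrapT => hm.
by have := min m (asboolT hm); rewrite ltnn.
Qed.

(** On the [k]-th dyadic shell around [x] the kernel is at most [(l / 2 ^ k.+1)
^ - s] and the shell has volume at most [(2 * l / 2 ^ k) ^ n]; the products
form a geometric series of ratio [2 ^ - (n - s)]. *)
Lemma inner_kernel_le s : (0 < s < n%:R)%R -> exists2 C, (0 < C)%R &
  forall l Q x, (0 < l)%R -> cube l Q -> Q x ->
    \int[vol]_(y in Q) ((euclid_dist x y `^ s)^-1)%:E <=
    (C * l `^ (n%:R - s))%:E.
Proof.
move=> /andP[s0 sn].
have ns0 : (0 < n%:R - s)%R by rewrite subr_gt0.
set z := (2^-1 `^ (n%:R - s) : R)%R.
have half_gt0 : (0 < 2^-1 :> R)%R by [].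
have z0 : (0 < z)%R by rewrite powR_gt0.
have z1 : (z < 1)%R.
  have <- : (1 `^ (n%:R - s) = 1 :> R)%R by rewrite powR1.
  by apply: gt0_ltr_powR; rewrite ?nnegrE// invf_lt1// ltr1n.
exists (2 `^ s * 2 ^+ n / (1 - z))%R.
  by rewrite divr_gt0 ?subr_gt0// mulr_gt0 ?powR_gt0 ?exprn_gt0.
move=> l Q x l0 cQ Qx; have [mQ vQ] := vol_cube l0 cQ.
pose r k := (l * 2^-1 ^+ k)%R.
have r0 k : (0 < r k)%R by rewrite mulr_gt0// exprn_gt0.
have cB k := centred_cubeP x (r k).
have r20 k : (0 < 2 * r k)%R by rewrite mulr_gt0.
have mB k : measurable (centred_cube x (r k)) by have [] := vol_cube (r20 k) (cB k).
have vB k : vol (centred_cube x (r k)) = ((2 * r k) ^+ n)%:E by have [] := vol_cube (r20 k) (cB k).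
pose t k (y : Rn) := ((r k.+1 `^ s)^-1)%:E * (\1_(centred_cube x (r k)) y)%:E.
have t0 k y : 0 <= t k y by rewrite mule_ge0// lee_fin invr_ge0 powR_ge0.
have mt k : measurable_fun setT (t k).
  by apply: measurable_funeM; apply/measurable_EFinP; exact: measurable_indic.
have mK : measurable_fun setT (fun z : Rn * Rn => ((euclid_dist z.1 z.2 `^ s)^-1)%:E).
  by apply/measurable_EFinP; exact: measurable_dist_kernel.
apply: (@le_trans _ _ (\int[vol]_(y in Q) \sum_(k <oo) t k y)).
  apply: ge0_le_integral => //.
  - by move=> y _; rewrite lee_fin invr_ge0 powR_ge0.
  - by apply: measurable_funTS; exact: (measurable_section _ mK).
  - apply: measurable_funTS; apply: ge0_emeasurable_sum => //.
  - move=> y Qy; have [xy|xy] := eqVneq x y.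
      by rewrite xy euclid_distxx powR0 ?gt_eqF// invr0 nneseries_ge0.
    have [|k [k1 k2]] := exists_shell l0 xy.
      by apply/centred_cube_norm; exact: (cube_coord_le cQ).
    apply: le_trans (nneseries_term_le k (t0 ^~ y)).
    rewrite /t indicE mem_set// mule1 lee_fin lef_pV2 ?posrE ?powR_gt0//; last first.
      exact: lt_le_trans (r0 _) (far_centred_cube k2).
    rewrite ge0_ler_powR ?nnegrE ?(ltW s0) ?euclid_dist_ge0 ?(ltW (r0 _))//.
    exact: far_centred_cube.
rewrite integral_nneseries//; last by move=> k; exact: measurable_funTS.
apply: (@le_trans _ _ (\sum_(k <oo) (2 `^ s * 2 ^+ n * l `^ (n%:R - s) * z ^+ k)%:E)).
  apply: lee_nneseries => [k _ _|k _]; first exact: integral_ge0.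
  apply: (@le_trans _ _ (\int[vol]_y t k y)).
    by apply: ge0_subset_integral => //; exact: measurable_funTS.
  rewrite ge0_integralZl_EFin ?invr_ge0 ?powR_ge0//; last first.
    by apply/measurable_EFinP; exact: measurable_indic.
  rewrite integral_indic// setIT.
  apply: (@le_trans _ _ (((r k.+1 `^ s)^-1)%:E * ((2 * r k) ^+ n)%:E)).
    by rewrite -vB.
  rewrite -EFinM lee_fin.
  have -> : r k.+1 = (2^-1 * r k)%R by rewrite /r exprS mulrCA.
  rewrite powRM ?(ltW (r0 _))// exprMn invfM.
  have -> : ((2^-1 `^ s)^-1 = 2 `^ s :> R)%R.
    by rewrite -powRN -(powR_inv1 (ler0n _ 2)) -powRrM mulN1r opprK.
  have zk : (z ^+ k = (2^-1 ^+ k) `^ (n%:R - s))%R.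
    rewrite -(powR_mulrn k (ltW z0)) -(powR_mulrn k (ltW half_gt0)) /z.
    by rewrite -!powRrM mulrC.
  have lr : (l `^ (n%:R - s) * z ^+ k = r k `^ (n%:R - s))%R.
    by rewrite zk -powRM ?(ltW l0)// exprn_ge0.
  have re : (r k `^ (n%:R - s) = r k ^+ n / r k `^ s)%R.
    by rewrite powRB ?(gt_eqF (r0 k)) ?implybT// powR_mulrn ?(ltW (r0 k)).
  rewrite -[leRHS]mulrA lr re le_eqVlt; apply/orP; left; apply/eqP.
  by ring.
have C0 : (0 <= 2 `^ s * 2 ^+ n * l `^ (n%:R - s))%R.
  by rewrite !mulr_ge0 ?powR_ge0// exprn_ge0.
apply: le_trans (nneseries_geometric_le C0 _) _; first by rewrite (ltW z0) z1.
by rewrite lee_fin mulrAC.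
Qed.

(** Compare [g x] and [g y] with [c]; by symmetry of the kernel both terms
contribute the integral of [|g x - c| ^ q] times the integral of the kernel in
the other variable. *)
Lemma energy_le_deviation q s : (1 <= q)%R -> (0 < s < n%:R)%R ->
  exists2 C, (0 < C)%R &
  forall g l Q (c : R), measurable_fun setT g -> (0 < l)%R -> cube l Q ->
    energy q s g Q <= (C * l `^ (n%:R - s))%:E *
      \int[vol]_(x in Q) (`|g x - c| `^ q)%:E.
Proof.
move=> q1 s0n; have [C C0 hC] := inner_kernel_le s0n.
exists (2 * 2 `^ (q - 1) * C)%R => [|g l Q c mg l0 cQ].
  by rewrite !mulr_gt0 ?powR_gt0.
have [mQ vQ] := vol_cube l0 cQ.
pose A x := (`|g x - c| `^ q)%:E.
have mA : measurable_fun setT A.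
  have m1 : measurable_fun setT (fun x : Rn => `|g x - c|%R).
    by apply: measurableT_comp => //; exact: measurable_funB.
  by apply/measurable_EFinP; exact: (measurableT_comp (measurable_powR q) m1).
have A0 x : 0 <= A x by rewrite lee_fin powR_ge0.
have AE x : A x = (`|g x - c| `^ q)%:E by [].
pose K (z : Rn * Rn) := ((euclid_dist z.1 z.2 `^ s)^-1)%:E.
have mK : measurable_fun setT K.
  by apply/measurable_EFinP; exact: measurable_dist_kernel.
have K0 z : 0 <= K z by rewrite lee_fin invr_ge0 powR_ge0.
have hK x : Q x -> \int[vol]_(y in Q) K (x, y) <= (C * l `^ (n%:R - s))%:E.
  by move=> Qx; exact: hC.
have KC x y : K (x, y) = K (y, x) by rewrite /K/= euclid_distC.
have oscAK x y : (osc q s g (x, y))%:E <=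
    (2 `^ (q - 1))%:E * (A x * K (x, y) + A y * K (x, y)).
  rewrite /osc /A /K/= lee_fin -mulrDl mulrA.
  apply: ler_wpM2r; first by rewrite invr_ge0 powR_ge0.
  by rewrite (distrC (g y)) powR_dist_le.
have EAK : \int[vol]_(x in Q) \int[vol]_(y in Q) (A x * K (x, y)) <=
    (C * l `^ (n%:R - s))%:E * \int[vol]_(x in Q) A x.
  have C1 : (0 <= C * l `^ (n%:R - s))%R by rewrite mulr_ge0 ?powR_ge0// ltW.
  rewrite -ge0_integralZl_EFin//; last exact: measurable_funTS.
  apply: ge0_le_integral => //.
  - by move=> x _; apply: integral_ge0 => y _; rewrite mule_ge0.
  - apply: measurable_funTS.
    apply: (measurable_inner_integral (@vol R n) mQ (F := fun z => A z.1 * K z)).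
      apply: emeasurable_funM => //; exact: (measurableT_comp mA measurable_fst).
    by move=> z; rewrite mule_ge0.
  - by apply: measurable_funTS; exact: measurable_funeM.
  - move=> x Qx; rewrite ge0_integralZl//; last 1 first.
    - by apply: measurable_funTS; exact: measurable_section.
    by rewrite muleC lee_wpmul2r//; exact: hK.
clearbody A K.
have mA1 : measurable_fun setT (fun z : Rn * Rn => A z.1 * K z).
  apply: emeasurable_funM => //; exact: (measurableT_comp mA measurable_fst).
have mA2 : measurable_fun setT (fun z : Rn * Rn => A z.2 * K z).
  apply: emeasurable_funM => //; exact: (measurableT_comp mA measurable_snd).
apply: (@le_trans _ _ (\int[vol]_(x in Q) \int[vol]_(y in Q)
   ((2 `^ (q - 1))%:E * (A x * K (x, y) + A y * K (x, y))))).
  apply: (le_iint (@vol R n) mQ (F := fun z => (osc q s g z)%:E)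
    (G := fun z => (2 `^ (q - 1))%:E * (A z.1 * K z + A z.2 * K z))).
  - exact: measurable_osc.
  - by move=> z; rewrite lee_fin osc_ge0.
  - by apply: measurable_funeM; exact: emeasurable_funD.
  - by move=> x y _ _; exact: oscAK.
  - by move=> z; rewrite mule_ge0 ?adde_ge0 ?mule_ge0// lee_fin powR_ge0.
rewrite (iintZ (@vol R n) mQ (F := fun z => A z.1 * K z + A z.2 * K z)) ?powR_ge0//; last 2 first.
- exact: emeasurable_funD.
- by move=> z; rewrite adde_ge0 ?mule_ge0.
rewrite (iintD (@vol R n) mQ (F := fun z => A z.1 * K z) (G := fun z => A z.2 * K z))//=; last 2 first.
- by move=> z; rewrite mule_ge0.
- by move=> z; rewrite mule_ge0.
rewrite [X in _ * (_ + X)](iintC (@vol R n) mQ (F := fun z => A z.2 * K z))//=; last first.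
  by move=> z; rewrite mule_ge0.
have -> : \int[vol]_(x in Q) \int[vol]_(y in Q) (A x * K (y, x)) =
   \int[vol]_(x in Q) \int[vol]_(y in Q) (A x * K (x, y)).
  by apply: eq_integral => x _; apply: eq_integral => y _; rewrite KC.
have := leeD EAK EAK; set I := \int[vol]_(x in Q) \int[vol]_(y in Q) _.
set J := \int[vol]_(x in Q) A x => h.
have J0 : 0 <= J by apply: integral_ge0.
apply: (@le_trans _ _ ((2 `^ (q - 1))%:E * ((C * l `^ (n%:R - s))%:E * J + (C * l `^ (n%:R - s))%:E * J))).
  by rewrite lee_wpmul2l// lee_fin powR_ge0.
have C1 : (0 <= C * l `^ (n%:R - s))%R by rewrite mulr_ge0 ?powR_ge0// ltW.
rewrite -ge0_muleDl ?lee_fin// -EFinD muleA -EFinM.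
rewrite le_eqVlt; apply/orP; left; apply/eqP; congr (_%:E * _).
  by ring.
by apply: eq_integral => x _; rewrite AE.
Qed.

End energy_const.

(** * The critical exponent *)

Lemma iint_nneseries d (T : measurableType d) (R : realType)
    (mu : {sigma_finite_measure set T -> \bar R}) (Q : set T)
    (F : nat -> T * T -> \bar R) : measurable Q ->
  (forall k, measurable_fun setT (F k)) -> (forall k z, 0 <= F k z) ->
  \int[mu]_(x in Q) \int[mu]_(y in Q) (\sum_(k <oo) F k (x, y)) =
  \sum_(k <oo) \int[mu]_(x in Q) \int[mu]_(y in Q) F k (x, y).
Proof.
move=> mQ mF F0; rewrite -integral_nneseries//.
- apply: eq_integral => x _; rewrite integral_nneseries// => k.
  by apply: measurable_funTS; exact: measurable_section.
- by move=> k; apply: measurable_funTS; exact: measurable_inner_integral.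
- by move=> k x _; exact: integral_ge0.
Qed.

Section energy_midpoint.
Context {R : realType} {n : nat}.
Hypothesis n0 : (0 < n)%N.
Notation Rn := 'rV[R]_n.
Implicit Types (q s l r : R) (g : Rn -> R) (Q : set Rn).

Definition near_diag r : set (Rn * Rn) :=
  [set z | (euclid_dist z.1 z.2 <= r)%R].

Lemma measurable_near_diag r : measurable (near_diag r).
Proof.
rewrite -[X in measurable X]setTI (_ : near_diag r =
  (fun z : Rn * Rn => euclid_dist z.1 z.2) @^-1` `]-oo, r]%classic).
  by apply: measurable_euclid_dist => //; exact: measurable_itv.
by apply/seteqP; split => z; rewrite /near_diag/= in_itv.
Qed.

Lemma measurable_osc_indic q s g (A : set (Rn * Rn)) : measurable_fun setT g ->
  measurable A ->
  measurable_fun setT (fun z => (osc q s g z * \1_A z)%:E).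
Proof.
move=> mg mA; apply/measurable_EFinP; apply: measurable_funM.
  by apply/measurable_EFinP; exact: measurable_osc.
exact: measurable_indic.
Qed.

Lemma osc_indic_ge0 q s g (A : set (Rn * Rn)) z : 0 <= (osc q s g z * \1_A z)%:E.
Proof. by rewrite lee_fin mulr_ge0 ?osc_ge0. Qed.

(** The midpoint is at half the distance from both ends, so the kernel there is
[2 ^ s] times larger. *)
Lemma osc_midpoint q s g r x y m : (1 <= q)%R -> m = (2^-1 *: (x + y))%R ->
  (osc q s g (x, y) * \1_(near_diag r) (x, y) <=
   2 `^ (q - 1) * 2^-1 `^ s *
   (osc q s g (x, m) * \1_(near_diag (2^-1 * r)) (x, m) +
    osc q s g (y, m) * \1_(near_diag (2^-1 * r)) (y, m)))%R.
Proof.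
move=> q1 mE.
have c0 : (0 <= 2 `^ (q - 1) * 2^-1 `^ s :> R)%R by rewrite mulr_ge0 ?powR_ge0.
have xm : euclid_dist x m = (2^-1 * euclid_dist x y)%R by rewrite mE euclid_dist_midpoint.
have ym : euclid_dist y m = (2^-1 * euclid_dist x y)%R.
  by rewrite (euclid_distC x) mE addrC euclid_dist_midpoint.
have [xyr|xyr] := leP (euclid_dist x y) r; last first.
  have -> : \1_(near_diag r) (x, y) = 0%R :> R.
    by rewrite indicE memNset// /near_diag/=; apply/negP; rewrite -ltNge.
  by rewrite mulr0 mulr_ge0// addr_ge0// mulr_ge0 ?osc_ge0.
have near_diag1 r' u v : (euclid_dist u v <= r')%R -> \1_(near_diag r') (u, v) = 1%R :> R.
  by move=> uv; rewrite indicE mem_set.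
rewrite !near_diag1// ?xm ?ym ?ler_pM2l//.
rewrite !mulr1 /osc/= xm ym powRM ?euclid_dist_ge0// invfM.
have h : (2^-1 `^ s != 0 :> R)%R by rewrite gt_eqF// powR_gt0.
rewrite -mulrDl mulrACA mulVKf//.
apply: ler_wpM2r; first by rewrite invr_ge0 powR_ge0.
by rewrite (distrC (g y)) powR_dist_le.
Qed.

(** Convexity of the cube keeps the midpoints inside [Q]. *)
Lemma integral_midpoint_le l Q x (h : Rn -> \bar R) : (0 < l)%R -> cube l Q -> Q x ->
  measurable_fun setT h -> (forall y, 0 <= h y) ->
  \int[vol]_(y in Q) h (2^-1 *: (x + y))%R <=
  (2 ^+ n)%:E * \int[vol]_(y in Q) h y.
Proof.
move=> l0 cQ Qx mh h0; have [mQ _] := vol_cube l0 cQ.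
have mhQ : measurable_fun setT (h \_ Q).
  by apply/(measurable_restrictT _ _).1 => //; exact: measurable_funTS.
have hQ0 y : 0 <= (h \_ Q) y by rewrite patchE; case: ifP.
have mm : measurable_fun setT (fun y : Rn => 2^-1 *: (x + y))%R.
  exact: (measurableT_comp (@measurable_midpoint R n) (pair1_measurable x)).
rewrite [X in _ * X]integral_mkcond -(integral_midpoint x mhQ hQ0) integral_mkcond.
apply: ge0_le_integral => //.
- by move=> y _; rewrite patchE; case: ifP.
- apply/(measurable_restrictT _ _).1 => //; apply: measurable_funTS.
  exact: measurableT_comp.
- exact: measurableT_comp.
- move=> y _; rewrite !patchE; case: ifPn => [/set_mem Qy|_]; last by case: ifP.
  by rewrite mem_set//; exact: (cube_midpoint cQ).
Qed.

(** The constants cancel exactly: [2 ^ (q - 1)] from convexity, [2 ^ - (n + q)]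
from the kernel, [2 ^ n] from the change of variables and [2] for the two
halves of the path multiply to [1]. *)
Lemma near_energy_half q g l Q r : (1 <= q)%R -> measurable_fun setT g ->
  (0 < l)%R -> cube l Q ->
  \int[vol]_(x in Q) \int[vol]_(y in Q)
    (osc q (n%:R + q) g (x, y) * \1_(near_diag r) (x, y))%:E <=
  \int[vol]_(x in Q) \int[vol]_(y in Q)
    (osc q (n%:R + q) g (x, y) * \1_(near_diag (2^-1 * r)) (x, y))%:E.
Proof.
move=> q1 mg l0 cQ; have [mQ _] := vol_cube l0 cQ.
set s := (n%:R + q)%R.
pose F z := (osc q s g z * \1_(near_diag (2^-1 * r)) z)%:E.
have mF : measurable_fun setT F.
  by apply: measurable_osc_indic => //; exact: measurable_near_diag.
have F0 z : 0 <= F z by exact: osc_indic_ge0.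
pose c := (2 `^ (q - 1) * 2^-1 `^ s : R)%R.
have c0 : (0 <= c)%R by rewrite mulr_ge0 ?powR_ge0.
have Fm x y : (osc q s g (x, y) * \1_(near_diag r) (x, y))%:E <=
    c%:E * (F (x, 2^-1 *: (x + y))%R + F (y, 2^-1 *: (x + y))%R).
  by rewrite -EFinD -EFinM lee_fin; exact: osc_midpoint.
rewrite -[leRHS]/(\int[vol]_(x in Q) \int[vol]_(y in Q) F (x, y)).
clearbody F.
(* The two halves of the path from [x] to [y] through the midpoint. *)
pose F1 (z : Rn * Rn) := F (z.1, 2^-1 *: (z.1 + z.2))%R.
pose F2 (z : Rn * Rn) := F (z.2, 2^-1 *: (z.1 + z.2))%R.
have mF1 : measurable_fun setT F1.
  apply: (measurableT_comp mF); apply: measurable_fun_pair => //.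
  exact: measurable_midpoint.
have mF2 : measurable_fun setT F2.
  apply: (measurableT_comp mF); apply: measurable_fun_pair => //.
  exact: measurable_midpoint.
have F21 x y : F2 (y, x) = F1 (x, y) by rewrite /F1 /F2 /= (addrC y).
have F1E x y : F1 (x, y) = F (x, 2^-1 *: (x + y))%R by [].
have Fm' x y : (osc q s g (x, y) * \1_(near_diag r) (x, y))%:E <=
    c%:E * (F1 (x, y) + F2 (x, y)) by exact: Fm.
have F10 z : 0 <= F1 z by exact: F0.
have F20 z : 0 <= F2 z by exact: F0.
clearbody F1 F2.
apply: (@le_trans _ _ (\int[vol]_(x in Q) \int[vol]_(y in Q) (c%:E * (F1 (x, y) + F2 (x, y))))).
  apply: (le_iint (@vol R n) mQ (F := fun z => (osc q s g z * \1_(near_diag r) z)%:E)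
     (G := fun z => c%:E * (F1 z + F2 z))).
  - by apply: measurable_osc_indic => //; exact: measurable_near_diag.
  - by move=> z; exact: osc_indic_ge0.
  - by apply: measurable_funeM; exact: emeasurable_funD.
  - by move=> x y _ _; exact: Fm'.
  - by move=> z; rewrite mule_ge0 ?adde_ge0.
rewrite (iintZ (@vol R n) mQ (F := fun z => F1 z + F2 z))//; last 2 first.
- exact: emeasurable_funD.
- by move=> z; rewrite adde_ge0.
rewrite (iintD (@vol R n) mQ (F := F1) (G := F2))//=.
have -> : \int[vol]_(x in Q) \int[vol]_(y in Q) F2 (x, y) =
          \int[vol]_(x in Q) \int[vol]_(y in Q) F1 (x, y).
  rewrite (iintC (@vol R n) mQ (F := F2))//.
  by apply: eq_integral => x _; apply: eq_integral => y _; exact: F21.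
set I := \int[vol]_(x in Q) \int[vol]_(y in Q) F (x, y).
have I1 : \int[vol]_(x in Q) \int[vol]_(y in Q) F1 (x, y) <= (2 ^+ n)%:E * I.
  rewrite -ge0_integralZl_EFin ?exprn_ge0//; last 2 first.
  - by move=> x _; exact: integral_ge0.
  - by apply: measurable_funTS; exact: measurable_inner_integral.
  apply: ge0_le_integral => //.
  - by move=> x _; exact: integral_ge0.
  - by apply: measurable_funTS; exact: measurable_inner_integral.
  - by apply: measurable_funTS; apply: measurable_funeM; exact: measurable_inner_integral.
  - move=> x Qx; under eq_integral do rewrite F1E.
    apply: (integral_midpoint_le l0 cQ Qx (h := fun y => F (x, y))) => //.
    exact: measurable_section.
have I0 : 0 <= I by apply: integral_ge0 => x _; exact: integral_ge0.
apply: (@le_trans _ _ (c%:E * ((2 ^+ n)%:E * I + (2 ^+ n)%:E * I))).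
  by rewrite lee_wpmul2l ?lee_fin// leeD.
rewrite -ge0_muleDl ?lee_fin ?exprn_ge0// -EFinD muleA -EFinM.
have -> : (c * (2 ^+ n + 2 ^+ n) = 1)%R; last by rewrite mul1e.
have -> : (2 ^+ n + 2 ^+ n = 2 * 2 `^ n%:R :> R)%R by rewrite powR_mulrn// mulr_natl mulr2n.
rewrite /c /s -(powR_inv1 (ler0n _ 2)) -powRrM mulN1r.
rewrite -[X in (_ * (X * _))%R](powRr1 (ler0n _ 2)) -!powRD ?pnatr_eq0 ?implybT//.
have -> : (q - 1 + - (n%:R + q) + (1 + n%:R) = 0)%R by ring.
exact: powRr0.
Qed.

(** By [near_energy_half] all of the energy sits in arbitrarily thin
neighbourhoods of the diagonal; their complements carry no energy since it is
finite, and these complements exhaust the set where the integrand does not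
vanish. *)
Lemma energy_lty_eq0 q g l Q : (1 <= q)%R -> measurable_fun setT g ->
  (0 < l)%R -> cube l Q -> energy q (n%:R + q) g Q < +oo ->
  energy q (n%:R + q) g Q = 0.
Proof.
move=> q1 mg l0 cQ Efin; have [mQ _] := vol_cube l0 cQ.
set s := (n%:R + q)%R in Efin *.
have q0 : (0 < q)%R by lra.
pose r k := (n%:R * l * 2^-1 ^+ k)%R.
pose N k z := (osc q s g z * \1_(near_diag (r k)) z)%:E.
pose G k z := (osc q s g z * \1_(~` near_diag (r k)) z)%:E.
have mN k : measurable_fun setT (N k).
  by apply: measurable_osc_indic => //; exact: measurable_near_diag.
have mG k : measurable_fun setT (G k).
  by apply: measurable_osc_indic => //; apply: measurableC; exact: measurable_near_diag.
have N0 k z : 0 <= N k z by exact: osc_indic_ge0.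
have G0 k z : 0 <= G k z by exact: osc_indic_ge0.
have NGE k z : (osc q s g z)%:E = N k z + G k z.
  rewrite -EFinD -mulrDr !indicE in_setC.
  by case: (z \in near_diag (r k)); rewrite /= ?addr0 ?add0r mulr1.
have NS k : \int[vol]_(x in Q) \int[vol]_(y in Q) N 0%N (x, y) <=
            \int[vol]_(x in Q) \int[vol]_(y in Q) N k (x, y).
  elim: k => [//|k IH]; apply: (le_trans IH).
  have := near_energy_half (r k) q1 mg l0 cQ.
  by rewrite /N/r exprS mulrCA.
have EN0 : energy q s g Q = \int[vol]_(x in Q) \int[vol]_(y in Q) N 0%N (x, y).
  rewrite /energy; apply: eq_integral => x /set_mem Qx.
  apply: eq_integral => y /set_mem Qy.
  rewrite /N indicE mem_set ?mulr1// /near_diag /r/= expr0 mulr1.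
  apply: euclid_dist_le => //; first exact: ltW.
  exact: (cube_coord_le cQ).
have GE k x y : (r k < euclid_dist x y)%R -> G k (x, y) = (osc q s g (x, y))%:E.
  move=> h; rewrite /G indicE mem_set ?mulr1// /near_diag/=.
  by apply/negP; rewrite -ltNge.
clearbody N G.
have IG k : \int[vol]_(x in Q) \int[vol]_(y in Q) G k (x, y) = 0.
  have ENG : energy q s g Q = \int[vol]_(x in Q) \int[vol]_(y in Q) N k (x, y) +
      \int[vol]_(x in Q) \int[vol]_(y in Q) G k (x, y).
    transitivity (\int[vol]_(x in Q) \int[vol]_(y in Q) (N k (x, y) + G k (x, y))).
      rewrite /energy; apply: eq_integral => x _; apply: eq_integral => y _.
      exact: NGE.
    exact: (iintD (@vol R n) mQ (mN k) (N0 k) (mG k) (G0 k)).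
  have IG0 : 0 <= \int[vol]_(x in Q) \int[vol]_(y in Q) G k (x, y).
    by apply: integral_ge0 => x _; exact: integral_ge0.
  have /fineK Ef : energy q s g Q \is a fin_num.
    by rewrite ge0_fin_numE; [exact: Efin|exact: energy_ge0].
  apply/eqP; rewrite eq_le IG0 andbT.
  have : energy q s g Q + \int[vol]_(x in Q) \int[vol]_(y in Q) G k (x, y) <= energy q s g Q.
    rewrite [leRHS]ENG; apply: leeD2r; rewrite EN0; exact: NS.
  by rewrite -Ef -[leRHS]adde0 leeD2lE.
apply/eqP; rewrite eq_le energy_ge0 andbT.
apply: (@le_trans _ _ (\int[vol]_(x in Q) \int[vol]_(y in Q) \sum_(k <oo) G k (x, y))).
  apply: (le_iint (@vol R n) mQ (F := fun z => (osc q s g z)%:E)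
    (G := fun z => \sum_(k <oo) G k z)).
  - exact: measurable_osc.
  - by move=> z; rewrite lee_fin osc_ge0.
  - exact: ge0_emeasurable_sum.
  - move=> x y _ _; have [->|xy] := eqVneq x y.
      by rewrite /osc/= subrr normr0 powR0 ?gt_eqF// mul0r nneseries_ge0.
    have d0 : (0 < euclid_dist x y)%R.
      rewrite lt0r euclid_dist_ge0 andbT; apply: contra xy => /eqP.
      by move=> /euclid_dist_eq0 ->.
    have nl0 : (0 <= n%:R * l)%R by rewrite mulr_ge0// ltW.
    have [k hk] := exists_half_pow_lt nl0 d0.
    apply: le_trans (nneseries_term_le k (G0 ^~ (x, y))).
    by rewrite GE.
  - by move=> z; exact: nneseries_ge0.
rewrite iint_nneseries//.
by rewrite eseries0// => k _ _; exact: IG.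
Qed.

End energy_midpoint.

(** * Passing from a Lebesgue measurable function to its Borel representative *)

(** The integral of a nonnegative function is a supremum over simple functions,
which gives monotonicity in the domain for arbitrary sets; it is applied to a
compact set. *)
Lemma ge0_integral_subset_le d (T : measurableType d) (R : realType)
    (mu : {measure set T -> \bar R}) (K Q : set T) (h : T -> \bar R) :
  (forall x, 0 <= h x) -> K `<=` Q ->
  \int[mu]_(x in K) h x <= \int[mu]_(x in Q) h x.
Proof.
move=> h0 KQ; rewrite !ge0_integralE//; apply: le_ereal_sup => _ [k kh <-].
exists k => // x; apply: (le_trans (kh x)); rewrite !patchE.
case: ifPn => [/set_mem/KQ Qx|_]; first by rewrite mem_set.
by case: ifP.
Qed.

Section transfer.
Context {R : realType} {n : nat}.
Hypothesis n0 : (0 < n)%N.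
Notation Rn := 'rV[R]_n.
Notation L := (lebesgue_rV R n).
Notation leb := (@lebesgue R n).
Variables (f : Rn -> \bar R) (N : set Rn) (g : Rn -> R).
Hypotheses (mN : measurable N) (N0 : vol N = 0).
Hypothesis mg : measurable_fun setT g.
Hypothesis fg : forall x, ~ N x -> f x = (g x)%:E.
Implicit Types (p q s l alpha : R) (Q : set Rn).

Lemma ae_leb_off (P : Rn -> Prop) : (forall x, ~ N x -> P x) ->
  {ae leb, forall x, P x}.
Proof.
move=> NP; exists N; split; first exact: borel_leb_measurable.
  by transitivity (vol N) => //; exact: leb_borelE.
by move=> x /=; apply: contra_notP => /NP.
Qed.

(** Completeness makes [h1] measurable, as it agrees almost everywhere with a
Borel function. *)
Lemma integral_leb_off (D : set Rn) (h1 h2 : Rn -> \bar R) : measurable D ->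
  measurable_fun setT h2 -> (forall x, ~ N x -> h1 x = h2 x) ->
  \int[leb]_(x in D) h1 x = \int[vol]_(x in D) h2 x.
Proof.
move=> mD mh2 h12; rewrite -integral_leb_borel//.
have mDL := borel_leb_measurable mD.
have mh2L : measurable_fun (D : set L) h2.
  by apply: measurable_funTS; exact: borel_measurable_leb.
have ae21 : ae_eq leb D h2 h1.
  by apply: ae_leb_off => x Nx _; rewrite h12.
have mh1L : measurable_fun (D : set L) h1.
  exact: (ae_measurable_fun leb_complete ae21).
by apply: ae_eq_integral => //; exact: ae_eq_sym.
Qed.

Lemma iint_energyE q s Q : measurable Q ->
  \int[leb]_(x in Q) \int[leb]_(y in Q)
     (`|f x - f y| `^ q * (euclid_dist x y `^ s)^-1%:E) = energy q s g Q.
Proof.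
move=> mQ; apply: integral_leb_off => //; first exact: measurable_inner_osc.
move=> x Nx; apply: integral_leb_off => //.
  apply: (measurable_section (F := fun z => (osc q s g z)%:E)).
  exact: measurable_osc.
by move=> y Ny; rewrite (fg Nx) (fg Ny).
Qed.

(** The exponent comes from [(l ^ n) ^ (q * alpha / n - 1) = l ^ (q * alpha -
n)]. *)
Lemma PhiE q alpha l Q : (0 < l)%R -> cube l Q ->
  Phi f q alpha Q =
  ((l `^ (q * alpha - n%:R))%:E * energy q (n%:R + q * alpha) g Q) `^ q^-1.
Proof.
move=> l0 cQ; have [mQ vQ] := vol_cube l0 cQ.
rewrite /Phi iint_energyE//; congr ((_ * _) `^ _).
have -> : leb Q = (l ^+ n)%:E by rewrite leb_borelE.
rewrite poweR_EFin -powR_mulrn ?(ltW l0)// -powRrM; congr (_ `^ _)%:E.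
by field; rewrite pnatr_eq0 -lt0n.
Qed.

Lemma mean_borelE h1 h2 l Q : (0 < l)%R -> cube l Q ->
  measurable_fun setT h2 -> (forall x, ~ N x -> h1 x = h2 x) ->
  mean h1 Q = ((l ^+ n)^-1)%:E * \int[vol]_(x in Q) h2 x.
Proof.
move=> l0 cQ mh2 h12; have [mQ vQ] := vol_cube l0 cQ.
rewrite /mean (integral_leb_off mQ mh2 h12).
have -> : leb Q = (l ^+ n)%:E by rewrite leb_borelE.
by rewrite inver expf_eq0 (gt_eqF l0) andbF.
Qed.

Lemma mean_oscE q l Q : (0 < l)%R -> cube l Q ->
  (@vol R n).-integrable Q (EFin \o g) ->
  mean (fun x => `|f x - mean f Q| `^ q) Q =
  ((l ^+ n)^-1)%:E * \int[vol]_(x in Q)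
    (`|g x - fine (\int[vol]_(y in Q) (g y)%:E) / l ^+ n| `^ q)%:E.
Proof.
move=> l0 cQ ig; have [mQ vQ] := vol_cube l0 cQ.
have -> : mean f Q = (fine (\int[vol]_(y in Q) (g y)%:E) / l ^+ n)%:E.
  rewrite (mean_borelE l0 cQ (h2 := EFin \o g))//; last exact/measurable_EFinP.
  rewrite -[X in _ * X]fineK; last exact: integrable_fin_num.
  by rewrite -EFinM mulrC.
set m := (_ / _)%R.
apply: mean_borelE => //; last by move=> x Nx; rewrite (fg Nx).
apply/measurable_EFinP.
have mn : measurable_fun setT (fun x : Rn => `|g x - m|%R).
  by apply: measurableT_comp => //; exact: measurable_funB.
exact: (measurableT_comp (measurable_powR q) mn).
Qed.

Lemma integrable_lebP (D : set Rn) : measurable D -> measurable_fun [set: L] f ->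
  leb.-integrable D f <-> (@vol R n).-integrable D (EFin \o g).
Proof.
move=> mD mf.
have E : \int[leb]_(x in D) `|f x| = \int[vol]_(x in D) `|(g x)%:E|.
  apply: integral_leb_off => //.
    by apply: measurableT_comp => //; exact/measurable_EFinP.
  by move=> x Nx; rewrite fg.
split => /integrableP[_ h]; apply/integrableP; split.
- by apply: measurable_funTS; exact/measurable_EFinP.
- by move: h; rewrite E.
- exact: measurable_funTS.
- by rewrite E.
Qed.

Lemma L1loc_integrable l Q : (0 < l)%R -> cube l Q -> L1loc f ->
  (@vol R n).-integrable Q (EFin \o g).
Proof.
move=> l0 cQ [[mf _] iK]; have [mQ _] := vol_cube l0 cQ.
apply/(integrable_lebP mQ mf).
have [a [b [c QE]]] := cQ.
pose K := [set x : Rn | forall i, `[a ord0 i, (a ord0 i + l)%R]%classic (x ord0 i)].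
have cK : compact K.
  apply: (@rV_compact R n (fun i => `[a ord0 i, (a ord0 i + l)%R]%classic)) => i.
  exact: segment_compact.
have mK : measurable K.
  by have [] := vol_box (I := fun i => `[a ord0 i, (a ord0 i + l)%R]) (fun i => lebesgue_measure_side (a ord0 i) true false l0).
apply: (integrableS (borel_leb_measurable mK) (borel_leb_measurable mQ) _ (iK K cK)).
rewrite QE => x /= Qx i; have := Qx i; rewrite !in_itv /= => /andP[h1 h2].
apply/andP; split; first by move: h1; case: (b i) => //= /ltW.
by move: h2; case: (c i) => //= /ltW.
Qed.

Lemma integrable_L1loc : lebesgue_measurable f ->
  (forall k, (@vol R n).-integrable (centred_cube 0 k.+1%:R) (EFin \o g)) ->
  L1loc f.
Proof.
move=> mf iQ; split => // K cK.
have [M [_ hM]] := compact_bounded cK.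
pose k := Num.bound `|M + 1|%R.
have KQ : K `<=` centred_cube 0 k.+1%:R.
  move=> x Kx i; rewrite mxE sub0r add0r in_itv/= -ler_norml.
  apply: (@le_trans _ _ `|x|%R).
    rewrite [in leRHS]/Num.norm/= mx_normrE.
    exact: (le_bigmax _ (fun ij : 'I_1 * 'I_n => `|x ij.1 ij.2|%R) (ord0, i)).
  apply: (@le_trans _ _ (M + 1)%R); first by apply: hM; rewrite // ltrDl.
  apply: (@le_trans _ _ k%:R); last by rewrite ler_nat.
  exact: le_trans (ler_norm _) (ltW (archi_boundP (normr_ge0 _))).
have l0 : (0 < 2 * k.+1%:R :> R)%R by rewrite mulr_gt0.
have [mQ _] := vol_cube l0 (centred_cubeP (0 : Rn) k.+1%:R).
have /integrableP[_ h] := (integrable_lebP mQ mf.1).2 (iQ k).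
apply/integrableP; split; first exact: measurable_funTS mf.1.
apply: le_lt_trans h; apply: ge0_integral_subset_le => //.
Qed.

End transfer.

(** * Suprema over congruent cubes and the comparison of seminorms *)

Lemma poweR_le_scale (R : realType) (r c : R) (A B : \bar R) : (0 <= r)%R ->
  (0 <= c)%R -> 0 <= A -> 0 <= B -> A <= c%:E * B ->
  A `^ r <= (c `^ r)%:E * B `^ r.
Proof.
move=> r0 c0 A0 B0 AB.
rewrite -poweR_EFin -poweRM//.
apply: gt0_ler_poweR => //; rewrite in_itv/= leey andbT//.
by rewrite mule_ge0.
Qed.

Section congruent.
Context {R : realType} {n : nat}.
Notation Rn := 'rV[R]_n.
Notation leb := (@lebesgue R n).
Implicit Types (a b A B : set Rn -> \bar R) (p c : R).

Lemma congruent_sup_ge0 p a : 0 <= congruent_sup p a.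
Proof.
apply: (@le_trans _ _ ((\esum_(Q in (set0 : set (set Rn))) a Q) `^ p^-1)).
  exact: poweR_ge0.
apply: ereal_sup_ubound; exists set0 => //; exists 1%R => //=.
by split => //; exact: trivIset_set0.
Qed.

Lemma congruent_sup_scale p c a b : (1 <= p)%R -> (0 < c)%R ->
  (forall Q, 0 <= a Q) -> (forall Q, 0 <= b Q) ->
  (forall l Q, (0 < l)%R -> cube l Q -> a Q <= c%:E * b Q) ->
  congruent_sup p a <= (c `^ p^-1)%:E * congruent_sup p b.
Proof.
move=> p1 c0 a0 b0 ab; have pV0 : (0 <= p^-1)%R by rewrite invr_ge0; lra.
apply: ge_ereal_sup => _ [C [l l0 [Cl Ctriv]] <-].
have esum_le : \esum_(Q in C) a Q <= c%:E * \esum_(Q in C) b Q.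
  apply: ge_ereal_sup => _ [X [finX XC] <-].
  apply: (@le_trans _ _ (\sum_(Q \in X) (c%:E * b Q))).
    by apply: lee_fsum => // Q XQ; apply: ab l0 (Cl _ (XC _ XQ)).
  rewrite -ge0_mule_fsumr// lee_wpmul2l ?lee_fin ?(ltW c0)//.
  by apply: esum_ge; exists X.
apply: (le_trans (poweR_le_scale pV0 (ltW c0) _ _ esum_le)).
- exact: esum_ge0.
- exact: esum_ge0.
rewrite lee_wpmul2l ?lee_fin ?powR_ge0//.
by apply: ereal_sup_ubound; exists C => //; exists l.
Qed.

Lemma congruent_sup_single p a l Q : (0 < l)%R -> cube l Q -> 0 <= a Q ->
  a Q `^ p^-1 <= congruent_sup p a.
Proof.
move=> l0 cQ aQ; apply: ereal_sup_ubound; exists [set Q]; last by rewrite esum_set1.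
exists l => //; split; first by move=> _ ->.
by move=> P S -> ->.
Qed.

(** This reduces each comparison of seminorms to a comparison on one cube, with
the same constant. *)
Lemma congruent_seminorm_scale p c A B : (1 <= p)%R -> (0 < c)%R ->
  (forall Q, 0 <= A Q) -> (forall Q, 0 <= B Q) ->
  (forall l Q, (0 < l)%R -> cube l Q -> A Q <= c%:E * B Q) ->
  congruent_sup p (fun Q => leb Q * A Q `^ p) <=
  c%:E * congruent_sup p (fun Q => leb Q * B Q `^ p).
Proof.
move=> p1 c0 A0 B0 AB; have p0 : (0 < p)%R by lra.
have -> : c = ((c `^ p) `^ p^-1)%R.
  by rewrite -powRrM divff ?gt_eqF// powRr1// ltW.
apply: congruent_sup_scale => //.
- exact: powR_gt0.
- by move=> Q; rewrite mule_ge0 ?poweR_ge0.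
- by move=> Q; rewrite mule_ge0 ?poweR_ge0.
- move=> l Q l0 cQ; rewrite muleCA lee_wpmul2l//.
  apply: poweR_le_scale; rewrite ?(ltW p0) ?(ltW c0)//.
  exact: AB l0 cQ.
Qed.

End congruent.

Section main.
Context {R : realType} {n : nat}.
Hypothesis n0 : (0 < n)%N.
Notation Rn := 'rV[R]_n.
Notation L := (lebesgue_rV R n).
Notation leb := (@lebesgue R n).
Implicit Types (f : Rn -> \bar R) (p q l alpha : R) (Q : set Rn).

Lemma Phi_ge0 f q alpha Q : 0 <= Phi f q alpha Q.
Proof. exact: poweR_ge0. Qed.

(** The [q]-th root makes the summand of the second seminorm the [p]-th power
of a quantity attached to the cube, as for [Phi]. *)
Definition mean_osc q f Q : \bar R :=
  mean (fun x => `|f x - mean f Q| `^ q) Q `^ q^-1.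

Lemma JNcon_normE p q f : JNcon_norm p q f =
  congruent_sup p (fun Q => leb Q * mean_osc q f Q `^ p).
Proof.
by congr congruent_sup; apply/funext => Q; rewrite -poweRrM (mulrC (q^-1)%R).
Qed.

(** The factors [l] cancel: raising the kernel exponent costs [(n * l) ^ (q *
(a2 - a1))], and the normalisations differ by [l ^ (q * (a2 - a1))]. *)
Lemma Phi_exponent_le q a1 a2 : (1 <= q)%R -> (a1 <= a2)%R ->
  exists2 C, (0 < C)%R & forall f l Q, lebesgue_measurable f -> (0 < l)%R ->
    cube l Q -> Phi f q a1 Q <= C%:E * Phi f q a2 Q.
Proof.
move=> q1 a12; have q0 : (0 < q)%R by lra.
have nR0 : (0 < n%:R :> R)%R by rewrite ltr0n.
exists ((n%:R `^ (q * (a2 - a1))) `^ q^-1)%R; first by rewrite !powR_gt0.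
move=> f l Q mf l0 cQ.
have [N [g [mN N0 mg fg]]] := borel_representative mf.
rewrite !(PhiE n0 mN N0 mg fg _ _ l0 cQ).
apply: poweR_le_scale.
- by rewrite invr_ge0 ltW.
- exact: powR_ge0.
- by rewrite mule_ge0 ?energy_ge0 ?lee_fin ?powR_ge0.
- by rewrite mule_ge0 ?energy_ge0 ?lee_fin ?powR_ge0.
have s12 : (n%:R + q * a1 <= n%:R + q * a2)%R by rewrite lerD2l ler_pM2l.
have := energy_exponent_le n0 q0 mg l0 cQ s12.
have c0 : (0 <= l `^ (q * a1 - n%:R))%R by exact: powR_ge0.
move=> /(lee_wpmul2l _) => /(_ (l `^ (q * a1 - n%:R))%:E); rewrite lee_fin => /(_ c0).
move=> /le_trans; apply; rewrite !muleA -!EFinM.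
rewrite le_eqVlt; apply/orP; left; apply/eqP; congr (_%:E * _).
rewrite powRM ?(ltW l0)// mulrCA -powRD; last by rewrite (gt_eqF l0) implybT.
by congr (_ `^ _ * _ `^ _)%R; ring.
Qed.

(** First increase [alpha] to an [a'] for which the kernel exponent [n + q *
a'] lies strictly between [0] and [n]; then the kernel is singular but
integrable. *)
Lemma Phi_le_mean_osc q alpha : (1 <= q)%R -> (alpha < 0)%R ->
  exists2 C, (0 < C)%R & forall f l Q, L1loc f -> (0 < l)%R -> cube l Q ->
    Phi f q alpha Q <= C%:E * mean_osc q f Q.
Proof.
move=> q1 a0; have q0 : (0 < q)%R by lra.
have nR0 : (0 < n%:R :> R)%R by rewrite ltr0n.
(* The bound [- n / (2 q)] keeps the kernel exponent at least [n / 2]. *)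
pose a' := Num.max alpha (- (n%:R / (2 * q)))%R.
have aa' : (alpha <= a')%R by rewrite le_max lexx.
have s0n : (0 < n%:R + q * a' < n%:R)%R.
  have h1 : (- (n%:R / (2 * q)) <= a')%R by rewrite le_max lexx orbT.
  have h2 : (a' < 0)%R by rewrite gt_max a0 oppr_lt0 divr_gt0// mulr_gt0.
  have h3 : (q * (- (n%:R / (2 * q))) <= q * a')%R by rewrite ler_pM2l.
  have h4 : (q * (- (n%:R / (2 * q))) = - (n%:R / 2))%R by field; rewrite gt_eqF.
  have h5 : (q * a' < 0)%R by rewrite pmulr_rlt0.
  by apply/andP; split; lra.
have [C1 C10 h1] := Phi_exponent_le q1 aa'.
have [C2 C20 h2] := energy_le_deviation q1 s0n.
(* [C1] is the cost of increasing the exponent, [C2] that of integrating the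
   kernel. *)
exists (C1 * C2 `^ q^-1)%R; first by rewrite mulr_gt0 ?powR_gt0.
move=> f l Q Lf l0 cQ; apply: (le_trans (h1 f l Q Lf.1 l0 cQ)).
rewrite EFinM -muleA lee_wpmul2l ?lee_fin ?(ltW C10)//.
have [N [g [mN N0 mg fg]]] := borel_representative Lf.1.
have ig := L1loc_integrable mN N0 mg fg l0 cQ Lf.
rewrite (PhiE n0 mN N0 mg fg _ _ l0 cQ) /mean_osc (mean_oscE mN N0 mg fg _ l0 cQ ig).
have ln0 : (0 < l ^+ n)%R by rewrite exprn_gt0.
apply: poweR_le_scale.
- by rewrite invr_ge0 ltW.
- exact: ltW.
- by rewrite mule_ge0 ?energy_ge0 ?lee_fin ?powR_ge0.
- rewrite mule_ge0 ?lee_fin ?invr_ge0 ?(ltW ln0)//.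
  by apply: integral_ge0 => x _; rewrite lee_fin powR_ge0.
have := h2 g l Q (fine (\int[vol]_(y in Q) (g y)%:E) / l ^+ n)%R mg l0 cQ.
have c0 : (0 <= l `^ (q * a' - n%:R))%R by exact: powR_ge0.
move=> /(lee_wpmul2l _) => /(_ (l `^ (q * a' - n%:R))%:E); rewrite lee_fin => /(_ c0).
move=> /le_trans; apply; rewrite !muleA -!EFinM.
rewrite le_eqVlt; apply/orP; left; apply/eqP; congr (_%:E * _).
rewrite mulrCA -powRD; last by rewrite (gt_eqF l0) implybT.
rewrite -powR_mulrn ?(ltW l0)// -powRN.
by congr (_ * _ `^ _)%R; ring.
Qed.

Lemma mean_osc_le_Phi q alpha : (1 <= q)%R ->
  exists2 C, (0 < C)%R & forall f l Q, L1loc f -> (0 < l)%R -> cube l Q ->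
    mean_osc q f Q <= C%:E * Phi f q alpha Q.
Proof.
move=> q1; have q0 : (0 < q)%R by lra.
have [C C0 hC] := iint_diffq_le_energy n0 (n%:R + q * alpha) q1.
exists (C `^ q^-1)%R; first by rewrite powR_gt0.
move=> f l Q Lf l0 cQ.
have [N [g [mN N0 mg fg]]] := borel_representative Lf.1.
have ig := L1loc_integrable mN N0 mg fg l0 cQ Lf.
rewrite (PhiE n0 mN N0 mg fg _ _ l0 cQ) /mean_osc (mean_oscE mN N0 mg fg _ l0 cQ ig).
have ln0 : (0 < l ^+ n)%R by rewrite exprn_gt0.
have lnV0 : (0 <= (l ^+ n)^-1)%R by rewrite invr_ge0 ltW.
apply: poweR_le_scale.
- by rewrite invr_ge0 ltW.
- exact: ltW.
- rewrite mule_ge0 ?lee_fin//.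
  by apply: integral_ge0 => x _; rewrite lee_fin powR_ge0.
- by rewrite mule_ge0 ?energy_ge0 ?lee_fin ?powR_ge0.
have h1 := mean_osc_le_iint q1 mg l0 cQ ig.
have h2 := hC g l Q mg l0 cQ.
have lnE : 0 <= ((l ^+ n)^-1)%:E by rewrite lee_fin.
apply: (le_trans (lee_wpmul2l lnE h1)).
apply: (le_trans (lee_wpmul2l lnE (lee_wpmul2l lnE h2))).
rewrite !muleA -!EFinM.
rewrite le_eqVlt; apply/orP; left; apply/eqP; congr (_%:E * _).
rewrite mulrCA; congr (_ * _)%R.
rewrite -powR_mulrn ?(ltW l0)// -powRN -!powRD ?(gt_eqF l0) ?implybT//.
by congr (_ `^ _)%R; ring.
Qed.

(** The seminorm is at least the contribution of the collection reduced to [Q].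
*)
Lemma JNQ_energy_le p q alpha f N g : (1 <= p)%R -> (1 <= q)%R ->
  measurable N -> vol N = 0 -> measurable_fun setT g ->
  (forall x, ~ N x -> f x = (g x)%:E) -> JNQ p q alpha f ->
  exists2 M, (0 <= M)%R & forall l Q, (0 < l)%R -> cube l Q ->
   (l `^ (alpha - n%:R * (q^-1 - p^-1)))%:E * energy q (n%:R + q * alpha) g Q `^ q^-1 <= M%:E.
Proof.
move=> p1 q1 mN N0 mg fg [mf Jf].
have q0 : (0 < q)%R by lra.
have p0 : (0 < p)%R by lra.
have J0 : 0 <= JNQ_norm p q alpha f by exact: congruent_sup_ge0.
have Jfin : JNQ_norm p q alpha f \is a fin_num by rewrite ge0_fin_numE.
exists (fine (JNQ_norm p q alpha f)); first exact: fine_ge0.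
move=> l Q l0 cQ; rewrite fineK//.
have [mQ vQ] := vol_cube l0 cQ.
have Q0 : 0 <= leb Q * Phi f q alpha Q `^ p by rewrite mule_ge0 ?poweR_ge0.
apply: le_trans (congruent_sup_single p l0 cQ Q0).
rewrite poweRM ?poweR_ge0// -poweRrM divff ?gt_eqF// poweRe1 ?Phi_ge0//.
have -> : leb Q = (l ^+ n)%:E by rewrite leb_borelE.
rewrite (PhiE n0 mN N0 mg fg _ _ l0 cQ) poweRM ?lee_fin ?powR_ge0 ?energy_ge0//.
rewrite !poweR_EFin muleA -EFinM.
rewrite le_eqVlt; apply/orP; left; apply/eqP; congr (_%:E * _).
rewrite -powR_mulrn ?(ltW l0)// -!powRrM -powRD ?(gt_eqF l0) ?implybT//.
by congr (_ `^ _)%R; field; rewrite !gt_eqF.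
Qed.

End main.

(** * The inclusions *)

Section inclusions.
Context {R : realType} {n : nat}.
Hypothesis n0 : (0 < n)%N.
Notation Rn := 'rV[R]_n.
Notation leb := (@lebesgue R n).
Variables p q : R.
Hypotheses (p1 : (1 <= p)%R) (q1 : (1 <= q)%R).
Implicit Types (f : Rn -> \bar R) (l alpha : R) (Q : set Rn).

Let p0 : (0 < p)%R. Proof. exact: lt_le_trans ltr01 p1. Qed.
Let q0 : (0 < q)%R. Proof. exact: lt_le_trans ltr01 q1. Qed.

Lemma energy_cube_lty alpha f N g l Q :
  measurable N -> vol N = 0 -> measurable_fun setT g ->
  (forall x, ~ N x -> f x = (g x)%:E) -> JNQ p q alpha f ->
  (0 < l)%R -> cube l Q -> energy q (n%:R + q * alpha) g Q < +oo.
Proof.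
move=> mN N0 mg fg Jf l0 cQ.
have [M M0 hM] := JNQ_energy_le n0 p1 q1 mN N0 mg fg Jf.
have := le_lt_trans (hM l Q l0 cQ) (ltry M).
rewrite !ltey; apply: contra => /eqP ->.
rewrite poweRyr; last by rewrite invr_eq0 gt_eqF.
by rewrite gt0_muley// lte_fin powR_gt0.
Qed.

Lemma JNQ_L1loc alpha f : JNQ p q alpha f -> L1loc f.
Proof.
move=> Jf; have [N [g [mN N0 mg fg]]] := borel_representative Jf.1.
apply: (integrable_L1loc mN N0 mg fg Jf.1) => k.
have l0 : (0 < 2 * k.+1%:R :> R)%R by rewrite mulr_gt0.
have cQ := centred_cubeP (0 : Rn) k.+1%:R.
apply: (energy_lty_integrable n0 q1 mg l0 cQ).
exact: (energy_cube_lty mN N0 mg fg Jf l0 cQ).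
Qed.

Lemma JNQ_norm_exponent_le a1 a2 : (a1 <= a2)%R ->
  exists2 C, (0 < C)%R & forall f, lebesgue_measurable f ->
    JNQ_norm p q a1 f <= C%:E * JNQ_norm p q a2 f.
Proof.
move=> a12; have [C C0 hC] := Phi_exponent_le n0 q1 a12.
exists C => // f mf; apply: congruent_seminorm_scale => // [Q|Q|l Q l0 cQ].
- exact: Phi_ge0.
- exact: Phi_ge0.
- exact: hC mf l0 cQ.
Qed.

Lemma JNQ_norm_le_JNcon_norm alpha : (alpha < 0)%R ->
  exists2 C, (0 < C)%R & forall f, L1loc f ->
    JNQ_norm p q alpha f <= C%:E * JNcon_norm p q f.
Proof.
move=> a0; have [C C0 hC] := Phi_le_mean_osc n0 q1 a0.
exists C => // f mf; rewrite JNcon_normE.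
apply: congruent_seminorm_scale => // [Q|Q|l Q l0 cQ].
- exact: Phi_ge0.
- exact: poweR_ge0.
- exact: hC mf l0 cQ.
Qed.

Lemma JNcon_norm_le_JNQ_norm alpha :
  exists2 C, (0 < C)%R & forall f, L1loc f ->
    JNcon_norm p q f <= C%:E * JNQ_norm p q alpha f.
Proof.
have [C C0 hC] := mean_osc_le_Phi n0 alpha q1.
exists C => // f mf; rewrite JNcon_normE.
apply: congruent_seminorm_scale => // [Q|Q|l Q l0 cQ].
- exact: poweR_ge0.
- exact: Phi_ge0.
- exact: hC mf l0 cQ.
Qed.

Lemma JNQ_nonincreasing a1 a2 : (a1 <= a2)%R ->
  JNQ (n := n) p q a2 `<=` JNQ p q a1.
Proof.
move=> a12 f [mf Jf]; split; first exact: mf.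
have [C C0 hC] := JNQ_norm_exponent_le a12.
apply: (le_lt_trans (hC f mf)); apply: lte_mul_pinfty; last exact: Jf.
  by rewrite lee_fin ltW.
by [].
Qed.

Lemma ae_constant_energy f N g s :
  measurable N -> vol N = 0 -> measurable_fun setT g ->
  (forall x, ~ N x -> f x = (g x)%:E) ->
  (forall k, energy q s g (centred_cube 0 k.+1%:R) = 0) -> ae_constant f.
Proof.
move=> mN N0 mg fg E0; have [c [A [mA A0 gA]]] := energy_eq0_ae_const q0 mg E0.
exists c; apply: (ae_leb_off (N := N `|` A)).
- exact: measurableU.
- apply/negligibleP; first exact: measurableU.
  by apply: negligibleU; apply/negligibleP.
- move=> x /not_orP[Nx Ax]; rewrite fg//.
  by congr EFin; apply: contrapT => gx; apply: Ax; exact: gA.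
Qed.

(** Energies increase along the exhaustion by cubes, while [JNQ_energy_le]
makes them tend to [0]. *)
Lemma JNQ_large_exponent alpha f : (n%:R * (q^-1 - p^-1) < alpha)%R ->
  JNQ p q alpha f -> ae_constant f.
Proof.
move=> pqa Jf; have [N [g [mN N0 mg fg]]] := borel_representative Jf.1.
apply: (ae_constant_energy mN N0 mg fg (s := (n%:R + q * alpha)%R)) => k.
have [M M0 hM] := JNQ_energy_le n0 p1 q1 mN N0 mg fg Jf.
pose d := (alpha - n%:R * (q^-1 - p^-1))%R; rewrite -/d in hM.
have d0 : (0 < d)%R by rewrite subr_gt0.
pose E j := energy q (n%:R + q * alpha) g (centred_cube 0 j.+1%:R).
have l0 j : (0 < 2 * j.+1%:R :> R)%R by rewrite mulr_gt0.
have cQ j := centred_cubeP (0 : Rn) j.+1%:R.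
have EM j : ((2 * j.+1%:R) `^ d)%:E * E j `^ q^-1 <= M%:E by exact: hM.
have Emono j : (k <= j)%N -> E k <= E j.
  move=> kj; have mQ i : measurable (centred_cube (0 : Rn) i.+1%:R).
    by have [] := vol_cube (l0 i) (cQ i).
  have kjQ : centred_cube (0 : Rn) k.+1%:R `<=` centred_cube 0 j.+1%:R.
    move=> x Qx i; have := Qx i; rewrite mxE !in_itv/= => /andP[h1 h2].
    have : (k.+1%:R <= j.+1%:R :> R)%R by rewrite ler_nat.
    by move=> h; apply/andP; split; lra.
  exact: le_energy.
apply: contrapT => Ek0.
have e0 : 0 < E k `^ q^-1.
  by rewrite poweR_gt0// lt0e energy_ge0 andbT; apply/eqP.
have efin : E k `^ q^-1 \is a fin_num.
  rewrite fin_num_poweR// ge0_fin_numE ?energy_ge0//.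
  exact: (energy_cube_lty mN N0 mg fg Jf (l0 k) (cQ k)).
set e := E k `^ q^-1 in e0 efin.
have r0 : (0 < fine e)%R by rewrite fine_gt0// e0 ltey_eq efin.
(* Any value above [M / e] contradicts the bound for the cube of index [j]. *)
pose B := ((M / fine e) + 1)%R.
have B0 : (0 < B)%R by rewrite ltr_wpDl// divr_ge0// ltW.
(* An index so large that [(2 * (j + 1)) ^ d] exceeds [M] divided by the
   supposed positive value. *)
pose j := maxn k (Num.bound (B `^ d^-1)).
have hj : (B <= (2 * j.+1%:R) `^ d)%R.
  have -> : B = ((B `^ d^-1) `^ d)%R by rewrite -powRrM mulVf ?gt_eqF// powRr1// ltW.
  apply: ge0_ler_powR; rewrite ?nnegrE ?powR_ge0 ?(ltW d0) ?(ltW (l0 _))//.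
  apply: le_trans (ltW (archi_boundP (powR_ge0 _ _))) _.
  apply: (@le_trans _ _ (j.+1%:R)); last by rewrite ler_peMl// ler1n.
  by rewrite ler_nat ltnW// ltnS leq_maxr.
have kj : (k <= j)%N by exact: leq_maxl.
clearbody j.
have eE : e <= E j `^ q^-1.
  apply: gt0_ler_poweR; last exact: Emono.
  - by rewrite invr_ge0 ltW.
  - by rewrite in_itv/= leey andbT; exact: energy_ge0.
  - by rewrite in_itv/= leey andbT; exact: energy_ge0.
have c0 : 0 <= ((2 * j.+1%:R) `^ d)%:E by rewrite lee_fin powR_ge0.
have := le_trans (lee_wpmul2l c0 eE) (EM j).
rewrite -(fineK efin) -EFinM lee_fin leNgt => /negP; apply.
apply: (@lt_le_trans _ _ (B * fine e)%R); last by rewrite ler_pM2r.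
by rewrite /B mulrDl divfK ?gt_eqF// mul1r ltrDl.
Qed.

Lemma JNQ_ge1 alpha f : (1 <= alpha)%R -> JNQ p q alpha f -> ae_constant f.
Proof.
move=> a1 /(JNQ_nonincreasing a1) Jf.
have [N [g [mN N0 mg fg]]] := borel_representative Jf.1.
apply: (ae_constant_energy mN N0 mg fg (s := (n%:R + q)%R)) => k.
have l0 : (0 < 2 * k.+1%:R :> R)%R by rewrite mulr_gt0.
have cQ := centred_cubeP (0 : Rn) k.+1%:R.
apply: (energy_lty_eq0 n0 q1 mg l0 cQ).
by have := energy_cube_lty mN N0 mg fg Jf l0 cQ; rewrite mulr1.
Qed.

Lemma ae_constant_JNQ alpha f : ae_constant f -> JNQ p q alpha f.
Proof.
move=> [c aec]; have mf : lebesgue_measurable f.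
  split; last by apply: filterS aec => x ->.
  apply: (ae_measurable_fun leb_complete (f := cst c%:E)); last exact: measurable_cst.
  by apply: filterS aec => x -> _.
split; first exact: mf.
have [N [mN fN N0]] := leb_negligible_hull aec.
have fc x : ~ N x -> f x = (cst c x)%:E.
  by move=> Nx; apply: contrapT => fx; apply: Nx; exact: fN.
apply: (@le_lt_trans _ _ 0); last by rewrite ltry.
apply: ge_ereal_sup => _ [C [l l0 [Cl _]] <-].
rewrite esum1; first by rewrite poweR0r// invr_eq0 gt_eqF.
move=> Q /Cl cQ; rewrite (PhiE n0 mN N0 (measurable_cst _) fc _ _ l0 cQ).
have -> : energy q (n%:R + q * alpha) (cst c) Q = 0.
  rewrite /energy integral0_eq// => x _; rewrite integral0_eq// => y _.
  by rewrite /osc/= subrr normr0 powR0 ?gt_eqF// mul0r.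
rewrite mule0 poweR0r ?invr_eq0 ?(gt_eqF q0)//.
by rewrite poweR0r ?(gt_eqF p0)// mule0.
Qed.

End inclusions.

Local Close Scope ereal_scope.

Theorem theorem2p7 (R : realType) (n : nat) (hn : (1 <= n)%N)
    (p q : R) (hp : 1 <= p) (hq : 1 <= q) :
  [/\ (* (i) *)
      forall alpha1 alpha2 : R, alpha1 <= alpha2 ->
        JNQ (n := n) p q alpha2 `<=` JNQ p q alpha1,
      (* (ii) *)
      forall alpha : R, n%:R * (q^-1 - p^-1) < alpha \/ 1 <= alpha ->
        JNQ (n := n) p q alpha = ae_constant
    & (* (iii) *)
      forall alpha : R, alpha < 0 ->
        JNQ (n := n) p q alpha = JNcon p q /\
        equivalent_norms (JNQ (n := n) p q alpha)
          (JNQ_norm p q alpha) (JNcon_norm p q)].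
Proof.
split=> [a1 a2 a12|alpha ha|alpha a0].
- exact: JNQ_nonincreasing.
- apply/seteqP; split => f; last exact: ae_constant_JNQ.
  by case: ha => ha Jf; [exact: JNQ_large_exponent ha Jf|exact: JNQ_ge1 ha Jf].
- have [C1 C10 h1] := JNQ_norm_le_JNcon_norm hn hp hq a0.
  have [C2 C20 h2] := JNcon_norm_le_JNQ_norm hn hp hq alpha.
  split; last first.
    exists C1, C2; split => // f /(JNQ_L1loc hn hp hq) Lf.
    by split; [exact: h1|exact: h2].
  apply/seteqP; split => f.
    move=> Jf; have Lf := JNQ_L1loc hn hp hq Jf; split => //.
    by apply: (le_lt_trans (h2 f Lf)); rewrite lte_mul_pinfty ?lee_fin ?(ltW C20) ?Jf.2.
  move=> [Lf Jf]; split; first exact: Lf.1.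
  by apply: (le_lt_trans (h1 f Lf)); rewrite lte_mul_pinfty ?lee_fin ?(ltW C10).
Qed.
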